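(* Let $F$ be a box-like self-affine set, the attractor of an IFS $\{S_i\}_{i\in\mathcal I}$ as described in the context, and let $P$ be the associated function defined in the context. Then $$\dim_{\mathrm P} F=\overline{\dim}_{\mathrm B} F\le s,$$ where $s\ge 0$ is the unique solution of $P(s)=1$. Furthermore, if the IFS $\{S_i\}_{i\in\mathcal I}$ satisfies the rectangular open set condition (ROSC), then $$\dim_{\mathrm P}F=\dim_{\mathrm B}F=s.$$
   Context: Box-like sets: $\mathcal I$ is a finite index set with $|\mathcal I|\ge 2$, and $\{S_i\}_{i\in\mathcal I}$ is an iterated function system (IFS) of maps $S_i:\mathbb R^2\to\mathbb R^2$ of the form $S_i=T_i\circ L_i+t_i$, where $T_i=\begin{pmatrix}a_i&0\\0&b_i\end{pmatrix}$ with $a_i,b_i\in(0,1)$, $L_i$ is a linear isometry of the plane with $L_i([-1,1]^2)=[-1,1]^2$, and $t_i\in\mathbb R^2$. The box-like self-affine set $F$ is the unique non-empty compact set with $F=\bigcup_{i\in\mathcal I}S_i(F)$. Words: $\mathcal I^*=\bigcup_{k\ge1}\mathcal I^k$; for $\mathbf i=(i_1,\dots,i_k)\in\mathcal I^*$ put $S_{\mathbf i}=S_{i_1}\circ\cdots\circ S_{i_k}$, and let $\alpha_1(\mathbf i)\ge\alpha_2(\mathbf i)$ be the singular values of the linear part of $S_{\mathbf i}$ (the side lengths of the rectangle $S_{\mathbf i}([0,1]^2)$, whose sides are parallel to the axes). Projections: $\pi_1(x,y)=x$, $\pi_2(x,y)=y$; $s_1=\dim_{\mathrm B}\pi_1(F)$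 and $s_2=\dim_{\mathrm B}\pi_2(F)$ (these box dimensions exist). Let $b(\mathbf i)=|\pi_1(S_{\mathbf i}[0,1]^2)|$ and $h(\mathbf i)=|\pi_2(S_{\mathbf i}[0,1]^2)|$ be the lengths of the base and height of $S_{\mathbf i}[0,1]^2$. Every $S_{\mathbf i}$ either maps horizontal lines to horizontal lines (type A) or horizontal lines to vertical lines (type B). Define $\pi_{\mathbf i}=\pi_1$ if ($\mathbf i$ is of type A and $b(\mathbf i)\ge h(\mathbf i)$) or ($\mathbf i$ is of type B and $b(\mathbf i)<h(\mathbf i)$), and $\pi_{\mathbf i}=\pi_2$ if ($\mathbf i$ is of type A and $b(\mathbf i)<h(\mathbf i)$) or ($\mathbf i$ is of type B and $b(\mathbf i)\ge h(\mathbf i)$). Put $s(\mathbf i)=\dim_{\mathrm B}\pi_{\mathbf i}(F)\in\{s_1,s_2\}$. Modified singular value function: for $s\ge0$, $\psi^s(S_{\mathbf i})=\alpha_1(\mathbf i)^{s(\mathbf i)}\alpha_2(\mathbf i)^{s-s(\mathbf i)}$, $\Psi_k^s=\sum_{\mathbf i\in\mathcal I^k}\psi^s(S_{\mathbf i})$ for $k\in\mathbb N$, and $P(s)=\lim_{k\to\infty}(\Psi_k^s)^{1/k}$ for $s\in[0,\infty)$ (the limit exists). There is a unique $s\ge0$ with $P(s)=1$. ROSC: there is a non-empty open rectangle $R=(a,b)\times(c,d)\subset\mathbb R^2$ such that the sets $S_i(R)$, $i\in\mathcal I$, are pairwise disjoint subsets of $R$. $\dim_{\mathrm P}$ is packing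 dimension, $\overline{\dim}_{\mathrm B}$ upper box-counting dimension, and $\dim_{\mathrm B}$ box-counting dimension; an equality involving $\dim_{\mathrm B}F$ includes the assertion that the lower and upper box dimensions of $F$ coincide. *)

(* Defs.v *)
From HB Require Import structures.
From mathcomp Require Import all_boot all_order all_algebra.
From mathcomp Require Import all_classical all_reals all_analysis.

Set Implicit Arguments.
Unset Strict Implicit.
Unset Printing Implicit Defensive.

Import Order.TTheory GRing.Theory Num.Theory.
Import numFieldNormedType.Exports.

Local Open Scope classical_set_scope.
Local Open Scope ring_scope.

(* The canonical norm of 'cV[R]_2 is the sup norm, so the Euclidean metric is
   introduced separately and the dimensions below take the metric as an
   argument. The two metrics induce the same topology, hence the library notion
   of compactness on 'cV[R]_2 is the usual one. *)
Definition eucl_dist (R : realType) (x y : 'cV[R]_2) : R :=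
  Num.sqrt (\sum_i (x i 0 - y i 0) ^+ 2).

Definition real_dist (R : realType) (x y : R) : R := `|x - y|.

Section box_dimension.
Variables (R : realType) (T : Type) (d : T -> T -> R).

(* Least number of sets of diameter at most delta covering A
   (+oo if no finite cover exists). *)
Definition cover_num (A : set T) (delta : R) : \bar R :=
  ereal_inf [set (n%:R)%:E | n in [set n : nat |
    exists U : 'I_n -> set T,
      A `<=` \bigcup_i U i /\
      forall i x y, U i x -> U i y -> d x y <= delta]].

Definition box_ratio (A : set T) (delta : R) : \bar R :=
  (lne (cover_num A delta) * ((- ln delta)^-1)%:E)%E.

Definition upper_box_dim (A : set T) : \bar R :=
  limf_esup (box_ratio A) 0^'+.

Definition lower_box_dim (A : set T) : \bar R :=
  limf_einf (box_ratio A) 0^'+.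

Definition has_box_dim (A : set T) (s : R) : Prop :=
  lower_box_dim A = s%:E /\ upper_box_dim A = s%:E.

End box_dimension.

Section packing_dimension.
Variables (R : realType) (T : choiceType) (d : T -> T -> R).

(* Balls are encoded by the pair (centre, radius). *)
Definition pball (p : T * R) : set T := [set y | d p.1 y <= p.2].

Definition is_packing (E : set T) (delta : R) (B : set (T * R)) : Prop :=
  [/\ countable B,
      forall p, B p -> E p.1 /\ 0 < p.2 <= delta
    & trivIset B pball].

(* The diameter of a ball of radius r is taken to be 2 r, which is correct for
   the Euclidean plane. *)
Definition packing_pre_delta (t delta : R) (E : set T) : \bar R :=
  ereal_sup [set (\esum_(p in B) ((2 * p.2) `^ t)%:E)%E |
             B in is_packing E delta].

Definition packing_pre (t : R) (E : set T) : \bar R :=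
  lim (packing_pre_delta t delta E @[delta --> 0^'+]).

Definition packing_measure (t : R) (E : set T) : \bar R :=
  ereal_inf [set (\sum_(0 <= k <oo) packing_pre t (C k))%E |
             C in [set C : nat -> set T | E `<=` \bigcup_k C k]].

Definition packing_dim (E : set T) : \bar R :=
  ereal_inf [set t%:E | t in
    [set t : R | 0 <= t /\ packing_measure t E = 0%E]].

End packing_dimension.

Section plane.
Variable R : realType.

Definition pi1 (x : 'cV[R]_2) : R := x 0 0.
Definition pi2 (x : 'cV[R]_2) : R := x 1 0.

Definition unit_square : set 'cV[R]_2 :=
  [set x | forall i, 0 <= x i 0 <= 1].

Definition centred_square : set 'cV[R]_2 :=
  [set x | forall i, -1 <= x i 0 <= 1].

Definition open_rect (a b c d : R) : set 'cV[R]_2 :=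
  [set x | a < pi1 x < b /\ c < pi2 x < d].

Definition hline (c : R) : set 'cV[R]_2 := [set x | pi2 x = c].
Definition vline (c : R) : set 'cV[R]_2 := [set x | pi1 x = c].

Definition typeA (f : 'cV[R]_2 -> 'cV[R]_2) : Prop :=
  forall c, exists c', f @` hline c = hline c'.
Definition typeB (f : 'cV[R]_2 -> 'cV[R]_2) : Prop :=
  forall c, exists c', f @` hline c = vline c'.

(* Singular values: square roots of the largest and the smallest eigenvalue of
   A^T A. In dimension 2 these are all of them, also when they coincide. *)
Definition alpha1 (A : 'M[R]_2) : R :=
  Num.sqrt (sup [set a | eigenvalue (A^T *m A) a]).
Definition alpha2 (A : 'M[R]_2) : R :=
  Num.sqrt (inf [set a | eigenvalue (A^T *m A) a]).

End plane.

Record box_like_ifs (R : realType) (I : finType) := BoxLikeIFS {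
  scx : I -> R;
  scy : I -> R;
  iso : I -> 'M[R]_2;
  trans : I -> 'cV[R]_2;
  scx_itv : forall i, 0 < scx i < 1;
  scy_itv : forall i, 0 < scy i < 1;
  iso_isometry : forall i x y,
    eucl_dist (iso i *m x) (iso i *m y) = eucl_dist x y;
  iso_square : forall i, mulmx (iso i) @` @centred_square R = @centred_square R
}.

Section box_like.
Variables (R : realType) (I : finType) (S : box_like_ifs R I).

Definition diag_part (i : I) : 'M[R]_2 :=
  diag_mx (\row_j (if j == 0 then scx S i else scy S i)).

Definition lin (i : I) : 'M[R]_2 := diag_part i *m iso S i.

Definition smap (i : I) (x : 'cV[R]_2) : 'cV[R]_2 := lin i *m x + trans S i.

Definition word_map (w : seq I) : 'cV[R]_2 -> 'cV[R]_2 :=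
  foldr (fun i f => smap i \o f) id w.

Definition word_lin (w : seq I) : 'M[R]_2 :=
  foldr (fun i A => lin i *m A) 1%:M w.

Lemma word_mapE (w : seq I) (x : 'cV[R]_2) :
  word_map w x = word_lin w *m x + word_map w 0.
Proof.
elim: w => [|i w IH] /=; first by rewrite mul1mx addr0.
by rewrite /smap IH mulmxDr mulmxA addrA.
Qed.

Definition is_attractor (F : set 'cV[R]_2) : Prop :=
  [/\ F !=set0, compact F & F = \bigcup_i (smap i @` F)].

(* Length of a bounded interval. *)
Definition len (J : set R) : R := sup J - inf J.

Definition base (w : seq I) : R :=
  len (@pi1 R @` (word_map w @` @unit_square R)).
Definition height (w : seq I) : R :=
  len (@pi2 R @` (word_map w @` @unit_square R)).

(* The condition under which pi_w = pi_1; otherwise pi_w = pi_2. *)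
Definition proj_is_pi1 (w : seq I) : Prop :=
  (typeA (word_map w) /\ height w <= base w) \/
  (typeB (word_map w) /\ base w < height w).

(* s1 and s2 stand for the box dimensions of pi_1(F) and pi_2(F). *)
Definition word_dim (s1 s2 : R) (w : seq I) : R :=
  if `[< proj_is_pi1 w >] then s1 else s2.

Definition psi (s1 s2 s : R) (w : seq I) : R :=
  alpha1 (word_lin w) `^ (word_dim s1 s2 w) *
  alpha2 (word_lin w) `^ (s - word_dim s1 s2 w).

Definition Psi (s1 s2 s : R) (k : nat) : R :=
  \sum_(w : k.-tuple I) psi s1 s2 s w.

(* If the limit did not exist the right-hand side would be the default value 0
   of R, so P s = 1 entails convergence. *)
Definition P (s1 s2 s : R) : R :=
  lim (Psi s1 s2 s k `^ (k%:R^-1) @[k --> \oo]).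

Definition ROSC : Prop :=
  exists a b c d : R,
    [/\ a < b, c < d,
        forall i, smap i @` open_rect a b c d `<=` open_rect a b c d
      & trivIset setT (fun i => smap i @` open_rect a b c d)].

End box_like.

(* Main.v *)
Require Import Defs.
From HB Require Import structures.
From mathcomp Require Import all_boot all_order all_algebra.
From mathcomp Require Import all_classical all_reals all_analysis.
From mathcomp Require Import zify ring lra.

Import Order.TTheory GRing.Theory Num.Theory.
Import numFieldNormedType.Exports.

Local Open Scope classical_set_scope.
Local Open Scope ring_scope.

Set Implicit Arguments.
Unset Strict Implicit.
Unset Printing Implicit Defensive.

(** The linear part of every word is a diagonal or antidiagonal matrix, because
the isometries preserve the square; so the cylinders of F lie in rectangles with
sides parallel to the axes, and a cylinder is a copy of F whose projection to its
longer side is a scaled copy of one of the two projections of F. At a scale r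
comparable to the shorter side of the rectangle, the number of sets needed to
cover the cylinder is thus the number needed to cover this projection at scale
r / alpha1, that is, up to r ^ epsilon, the modified singular value of the word
(with exponent t) times r ^ - t ([scale_le], [scale_ge]). Everything is applied
to the stopping set of the words whose shorter side has just dropped below r.

Upper bound ([upper_box_dim_attractor]). The cylinders of the stopping set cover
F, and for t > s the sum of the modified singular values over all words
converges, since the k-th root of Psi_k tends to one at s, so that
Psi_k decays exponentially above s.

Lower bound ([lower_box_dim_attractor]). Under the rectangular open set condition
the images of the open rectangle under the words of the stopping set are
disjoint and have sides at least comparable to r, so a set of diameter r
meets boundedly many cylinders ([antichain_meeting_bound]); double counting shows
that the covering number of F is at least the sum of those of the cylinders, up
to a constant ([antichain_sum_le]). It remains to see that for t < s the modified
singular values of a stopping set do not have a small sum. First, s <= s1 + s2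
([exponent_le_dim_sum]): F is contained in the product of its projections, so for
t > s1 + s2 the sums over antichains of comparable rectangles are bounded and
Psi_k grows at most linearly. Next, for t <= s1 + s2 the modified singular value
is submultiplicative ([psi_submultiplicative]), using that s1 = s2 as soon as
some map exchanges the two directions. Then a stopping set with sum at most one
would force Psi_k to be bounded ([submultiplicative_bounded]), which fails for
t < s.

Packing dimension ([packing_dim_attractor]). It is at most the upper box
dimension for every non-empty set, by grouping the balls of a packing dyadically. For the
converse, cover F by countably many sets of finite packing pre-measure; by the
Baire category argument, in the form of nested cylinders, the closure of one of
them contains a cylinder of F, which has the upper box dimension of F. *)

(** * Covering numbers and box dimensions *)

Section covering.
Context {R : realType} {T : Type} (d : T -> T -> R).
Implicit Types (A B : set T) (r u : R).

Definition covered A r (n : nat) : Prop :=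
  exists U : 'I_n -> set T,
    A `<=` \bigcup_i U i /\ forall i x y, U i x -> U i y -> d x y <= r.

Lemma covered_sub A B r n : A `<=` B -> covered B r n -> covered A r n.
Proof. by move=> AB [U [cU dU]]; exists U; split => //; apply: subset_trans cU. Qed.

Lemma covered_le A r r' n : r <= r' -> covered A r n -> covered A r' n.
Proof.
move=> rr' [U [cU dU]]; exists U; split => // i x y ux uy.
exact: le_trans (dU i x y ux uy) rr'.
Qed.

Lemma covered_union A B r m n :
  covered A r m -> covered B r n -> covered (A `|` B) r (m + n).
Proof.
move=> [U [cU dU]] [V [cV dV]].
exists (fun i => match fintype.split i with inl j => U j | inr k => V k end).
split=> [x [/cU [j _ Ux]|/cV [j _ Vx]]|i x y].
- by exists (lshift n j) => //=; rewrite (unsplitK (inl j)).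
- by exists (rshift m j) => //=; rewrite (unsplitK (inr j)).
- by case: (fintype.split i) => j; [apply: dU|apply: dV].
Qed.

Lemma covered_bigcup (W : eqType) (s : seq W) (A : W -> set T) (n : W -> nat) r :
  (forall w, w \in s -> covered (A w) r (n w)) ->
  covered [set x | exists2 w, w \in s & A w x] r (\sum_(w <- s) n w)%N.
Proof.
elim: s => [_|w s IH h].
  rewrite big_nil; exists (fun=> set0); split => [x [w]|//].
  by rewrite in_nil.
rewrite big_cons; apply: (covered_sub (B := A w `|` [set x | exists2 v, v \in s & A v x])).
  move=> x [v]; rewrite inE => /orP[/eqP ->|vs] Ax; first by left.
  by right; exists v.
apply: covered_union; first by apply: h; rewrite mem_head.
by apply: IH => v vs; apply: h; rewrite inE vs orbT.
Qed.

Lemma covered_neq0 A r n : A !=set0 -> covered A r n -> (0 < n)%N.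
Proof.
move=> [x Ax] [U [cU _]]; case: n U cU => [|//] U cU.
by have [[]] := cU x Ax.
Qed.

Lemma cover_num_le A r n : covered A r n -> (cover_num d A r <= n%:R%:E)%E.
Proof. by move=> h; apply: ereal_inf_lbound; exists n. Qed.

Lemma cover_num_lt A r x : (cover_num d A r < x)%E ->
  exists2 n, covered A r n & (n%:R%:E < x)%E.
Proof. by move=> /ereal_inf_lt [_ [n hn <-] h]; exists n. Qed.

Lemma cover_num_ge A r x :
  (forall n, covered A r n -> (x <= n%:R%:E)%E) -> (x <= cover_num d A r)%E.
Proof. by move=> h; apply: le_ereal_inf_tmp => _ [n hn <-]; apply: h. Qed.

Lemma cover_num_ge0 A r : (0 <= cover_num d A r)%E.
Proof. by apply: cover_num_ge => n _; rewrite lee_fin ler0n. Qed.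

End covering.

Section powers.
Context {R : realType}.
Implicit Types (x y a u v e : R).

Lemma powRDp x u v : 0 < x -> x `^ (u + v) = x `^ u * x `^ v.
Proof. by move=> x0; rewrite powRD// (gt_eqF x0) implybT. Qed.

Lemma powR_exp x u : 0 < x -> x `^ u = expR (u * ln x).
Proof. by move=> x0; rewrite /powR gt_eqF. Qed.

Lemma powR_le1 x u : 0 < x <= 1 -> 0 <= u -> x `^ u <= 1.
Proof. by move=> x01 u0; rewrite -(powRr0 x) ger_powR. Qed.

Lemma powR_lel x y u : 0 <= u -> 0 < x -> x <= y -> x `^ u <= y `^ u.
Proof.
move=> u0 x0 xy; rewrite ge0_ler_powR// nnegrE ltW//.
exact: lt_le_trans xy.
Qed.

(** A power is monotone in its base, in a direction that depends on the sign of
the exponent; adding the values at both ends covers the two cases. *)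
Lemma powR_itv_le x a b u : 0 < a -> a <= x -> x <= b ->
  x `^ u <= a `^ u + b `^ u.
Proof.
move=> a0 ax xb; have x0 := lt_le_trans a0 ax.
have [u0|u0] := leP 0 u.
  by rewrite -[leLHS]add0r lerD ?powR_ge0// powR_lel.
rewrite -[leLHS]addr0 lerD ?powR_ge0//.
have E z : z `^ u = (z `^ (- u))^-1 by rewrite powRN invrK.
rewrite !E lef_pV2 ?posrE ?powR_gt0// powR_lel//.
by rewrite oppr_ge0 ltW.
Qed.

Lemma at_right0P (V : set R) :
  nbhs 0^'+ V <-> exists2 e, 0 < e & forall r, 0 < r < e -> V r.
Proof.
split=> [[/= e e0 h]|[e e0 h]].
  exists e => // r /andP[r0 re]; apply: h => //=.
  by rewrite sub0r normrN gtr0_norm.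
exists e => //= r /= re r0; apply: h.
by rewrite r0/= -(gtr0_norm r0) -normrN -[X in `|X|]sub0r.
Qed.

End powers.

Section box_dimension_bounds.
Context {R : realType} {T : Type} (d : T -> T -> R).
Implicit Types (A B : set T) (t u e C : R).

Local Notation covered := (covered d).

(** Comparing a box ratio with t is comparing the covering number with r ^ - t;
this trades the extended logarithms for powers. *)
Lemma ratio_le (N : \bar R) r t : 0 < r < 1 -> (0 <= N)%E ->
  (lne N * ((- ln r)^-1)%:E <= t%:E)%E = (N <= (r `^ (- t))%:E)%E.
Proof.
move=> /andP[r0 r1] N0.
have l0 : 0 < - ln r by rewrite oppr_gt0 ln_lt0// r0 r1.
rewrite (lee_pdivrMr (r := - ln r))//.
have -> : (t%:E * (- ln r)%:E)%E = lne ((r `^ (- t))%:E) :> \bar R.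
  by rewrite lne_EFin ?powR_gt0// ln_powR -EFinM mulNr mulrN.
rewrite lee_lne// in_itv/= ?leey ?N0//.
by rewrite lee_fin powR_ge0.
Qed.

Lemma ratio_ge (N : \bar R) r t : 0 < r < 1 -> (0 <= N)%E ->
  (t%:E <= lne N * ((- ln r)^-1)%:E)%E = ((r `^ (- t))%:E <= N)%E.
Proof.
move=> /andP[r0 r1] N0.
have l0 : 0 < - ln r by rewrite oppr_gt0 ln_lt0// r0 r1.
rewrite (lee_pdivlMr (r := - ln r))//.
have -> : (t%:E * (- ln r)%:E)%E = lne ((r `^ (- t))%:E) :> \bar R.
  by rewrite lne_EFin ?powR_gt0// ln_powR -EFinM mulNr mulrN.
rewrite lee_lne// in_itv/= ?leey ?N0//.
by rewrite lee_fin powR_ge0.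
Qed.

(** The factor 2 makes the inequality strict, so that a member of the set whose
infimum is the covering number satisfies it. *)
Lemma upper_box_dim_ltP A t : (upper_box_dim d A < t%:E)%E ->
  exists2 e, 0 < e & forall r, 0 < r < e ->
    exists n, covered A r n /\ n%:R <= r `^ (- t) *+ 2.
Proof.
move=> /ereal_inf_lt [_ [V /at_right0P [e e0 hV] <-] supV].
exists (Num.min e 1); first by rewrite lt_min e0/=.
move=> r /andP[r0]; rewrite lt_min => /andP[re r1].
have : (box_ratio d A r <= t%:E)%E.
  apply: le_trans (ltW supV); apply: ereal_sup_ubound; exists r => //.
  by apply: hV; rewrite r0.
rewrite /box_ratio ratio_le ?r0//; last exact: cover_num_ge0.
move=> h; have /cover_num_lt [n hn nlt] : (cover_num d A r < (r `^ (- t) *+ 2)%:E)%E.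
  by apply: le_lt_trans h _; rewrite lte_fin mulr2n ltrDl powR_gt0.
by exists n; split => //; rewrite -lee_fin ltW.
Qed.

Lemma lower_box_dim_gtP A t : (t%:E < lower_box_dim d A)%E ->
  exists2 e, 0 < e & forall r, 0 < r < e ->
    forall n, covered A r n -> r `^ (- t) <= n%:R.
Proof.
rewrite /lower_box_dim limf_einfE.
move=> /ereal_sup_gt [_ [V /at_right0P [e e0 hV] <-] infV].
exists (Num.min e 1); first by rewrite lt_min e0/=.
move=> r /andP[r0]; rewrite lt_min => /andP[re r1] n hn.
have : (t%:E <= box_ratio d A r)%E.
  apply: le_trans (ltW infV) _; apply: ereal_inf_lbound; exists r => //.
  by apply: hV; rewrite r0.
rewrite /box_ratio ratio_ge ?r0//; last exact: cover_num_ge0.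
by move=> h; rewrite -lee_fin (le_trans h)// cover_num_le.
Qed.

(** A multiplicative constant is swallowed by an arbitrarily small change of the
exponent. *)
Lemma const_le_powR C e : 0 < e ->
  exists2 r0 : R, 0 < r0 & forall r, 0 < r < r0 -> C <= r `^ (- e).
Proof.
move=> e0; exists (expR (- (`|C| / e))); first exact: expR_gt0.
move=> r /andP[r0 rlt]; rewrite powR_exp//.
have : ln r < - (`|C| / e) by rewrite -ltr_expR lnK.
rewrite ltrNr -(ltr_pM2l e0) mulrCA divff ?gt_eqF// mulr1 => h.
apply: le_trans (expR_ge1Dx _); apply: le_trans (ler_norm C) _.
by rewrite mulNr -mulrN (le_trans (ltW h))// lerDr.
Qed.

(** Neither the constant C nor a rescaling of the diameters by M affects the
dimension. *)
Lemma upper_box_dim_le A t C M e : 0 < C -> 0 < M -> 0 < e ->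
  (forall r, 0 < r < e -> exists2 n, covered A (M * r) n & n%:R <= C * r `^ (- t)) ->
  (upper_box_dim d A <= t%:E)%E.
Proof.
move=> C0 M0 e0 h; apply/lee_addgt0Pr => x x0.
have [r0 r00 hr0] := const_le_powR (C * M `^ t) x0.
apply: ge_ereal_inf.
set V := [set r | 0 < r < Num.min (M * e) (Num.min r0 1)].
exists (ereal_sup (box_ratio d A @` V)).
  exists V => //; apply/at_right0P; exists (Num.min (M * e) (Num.min r0 1)) => //.
  by rewrite !lt_min r00 mulr_gt0 //=.
apply: ge_ereal_sup => _ [r + <-]; rewrite /V /= !lt_min => /andP[rp /and3P[re rr0 r1]].
rewrite /box_ratio -EFinD ratio_le ?rp//; last exact: cover_num_ge0.
have [|n hn nle] := h (r / M); first by rewrite divr_gt0//= ltr_pdivrMr// mulrC.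
rewrite mulrCA divff ?gt_eqF// mulr1 in hn.
apply: (le_trans (cover_num_le hn)); rewrite lee_fin (le_trans nle)//.
have -> : (r / M) `^ (- t) = r `^ (- t) * M `^ t.
  by rewrite powRM ?invr_ge0 ?ltW// -powR_inv1 ?ltW// -powRrM mulrNN mul1r.
rewrite opprD powRDp// mulrCA ler_wpM2l ?powR_ge0//.
by apply: hr0; rewrite rp.
Qed.

Lemma lower_box_dim_ge A t C e : 0 < C -> 0 < e ->
  (forall r n, 0 < r < e -> covered A r n -> C * r `^ (- t) <= n%:R) ->
  (t%:E <= lower_box_dim d A)%E.
Proof.
move=> C0 e0 h; apply/lee_subgt0Pr => x x0.
have [r0 r00 hr0] := const_le_powR C^-1 x0.
rewrite /lower_box_dim limf_einfE; apply: le_ereal_sup_tmp.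
set V := [set r | 0 < r < Num.min e (Num.min r0 1)].
exists (ereal_inf (box_ratio d A @` V)).
  exists V => //; apply/at_right0P; exists (Num.min e (Num.min r0 1)) => //.
  by rewrite !lt_min r00 e0 //=.
apply: le_ereal_inf_tmp => _ [r + <-]; rewrite /V /= !lt_min => /andP[rp /and3P[re rr0 r1]].
rewrite /box_ratio -EFinB ratio_ge ?rp//; last exact: cover_num_ge0.
apply: cover_num_ge => n hn; rewrite lee_fin.
apply: le_trans (h r n _ hn); last by rewrite rp.
have : C^-1 <= r `^ (- x) by apply: hr0; rewrite rp.
rewrite opprB addrC powRDp// mulrC => hC; apply: ler_wpM2r; first exact: powR_ge0.
rewrite -(invrK C) -(invrK (r `^ x)) lef_pV2 ?posrE ?invr_gt0 ?powR_gt0//.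
by rewrite -powRN.
Qed.

Lemma box_dim_ge0 A s : A !=set0 -> has_box_dim d A s -> 0 <= s.
Proof.
move=> A0 [hl _]; rewrite -lee_fin -hl.
apply: (@lower_box_dim_ge A 0 1 1) => // r n _ hn.
rewrite oppr0 powRr0 mulr1 ler1n.
exact: covered_neq0 A0 hn.
Qed.

Lemma lower_le_upper_box_dim A : (lower_box_dim d A <= upper_box_dim d A)%E.
Proof.
rewrite leNgt; apply/negP; rewrite /lower_box_dim limf_einfE.
move=> /ereal_inf_lt[_ [V /at_right0P[e e0 hV] <-]].
move=> /ereal_sup_gt[_ [W /at_right0P[f f0 hW] <-]]; rewrite ltNge => /negP; apply.
set r := Num.min e f / 2.
have r0 : 0 < r by rewrite divr_gt0// lt_min e0.
have rlt : r < Num.min e f by rewrite gtr_pMr ?invf_lt1 ?ltr1n// lt_min e0.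
move: rlt; rewrite lt_min => /andP[re rf].
apply: (@le_trans _ _ (box_ratio d A r)).
  by apply: ereal_inf_lbound; exists r => //; apply: hW; rewrite r0.
by apply: ereal_sup_ubound; exists r => //; apply: hV; rewrite r0.
Qed.

(** Uniform versions of the definition of the box dimension: a constant takes
care of the scales that are not small. *)
Lemma covered_unif A s u b : A !=set0 -> has_box_dim d A s -> s < u -> 0 < b ->
  exists2 C, 0 < C & forall r, 0 < r <= b ->
    exists2 n, covered A r n & n%:R <= C * r `^ (- u).
Proof.
move=> A0 hA su b0; have u0 : 0 <= u by rewrite ltW// (le_lt_trans (box_dim_ge0 A0 hA)).
have [|e e0 h] := @upper_box_dim_ltP A u; first by case: hA => _ ->; rewrite lte_fin.
have [|m [hm _]] := h (e / 2).
  by rewrite divr_gt0//= gtr_pMr ?invf_lt1 ?ltr1n.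
exists (2 + m%:R * b `^ u); first by rewrite ltr_wpDr// mulr_ge0// powR_ge0.
move=> r /andP[r0 rb]; have [re|er] := ltP r e.
  have [|n [hn nle]] := h r; first by rewrite r0.
  exists n => //; apply: (le_trans nle); rewrite -mulr_natl ler_wpM2r ?powR_ge0//.
  by rewrite lerDl mulr_ge0// powR_ge0.
exists m; first by apply: covered_le hm; apply: le_trans er; rewrite ler_pdivrMr// ler_peMr ?ler1n// ltW.
rewrite powRN ler_pdivlMr ?powR_gt0//.
rewrite -[leLHS]add0r lerD// ler_wpM2l//.
exact: powR_lel.
Qed.

Lemma covered_unif_ge A s u b : A !=set0 -> has_box_dim d A s -> u < s -> 0 < b ->
  exists2 C, 0 < C & forall r n, 0 < r <= b ->
    covered A r n -> C * r `^ (- u) <= n%:R.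
Proof.
move=> A0 hA us b0.
have [|e e0 h] := @lower_box_dim_gtP A u; first by case: hA => -> _; rewrite lte_fin.
pose K := 1 + (e `^ (- u) + b `^ (- u)).
have K0 : 0 < K by rewrite ltr_wpDr// addr_ge0// powR_ge0.
exists K^-1; first by rewrite invr_gt0.
move=> r n /andP[r0 rb] hn; rewrite ler_pdivrMl//; have [re|er] := ltP r e.
  apply: (@le_trans _ _ n%:R); first by apply: h => //; rewrite r0.
  by rewrite ler_peMl// lerDl addr_ge0// powR_ge0.
apply: (@le_trans _ _ (K * 1)).
  rewrite mulr1 (le_trans (powR_itv_le _ e0 er rb))//.
  by rewrite lerDr.
rewrite ler_pM2l// ler1n; exact: covered_neq0 A0 hn.
Qed.

End box_dimension_bounds.

(** * Monomial matrices: the linear parts of the maps *)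

Section plane_coordinates.
Context {R : realType}.
Implicit Types (x y : 'cV[R]_2) (A B : 'M[R]_2).

Definition vec2 (a b : R) : 'cV[R]_2 := \col_i (if i == 0 then a else b).

Lemma vec2_0 a b : vec2 a b 0 0 = a. Proof. by rewrite mxE. Qed.
Lemma vec2_1 a b : vec2 a b 1 0 = b. Proof. by rewrite mxE. Qed.

Lemma ord2P (P : 'I_2 -> Prop) : P 0 -> P 1 -> forall i, P i.
Proof.
move=> P0 P1 i; have [->//|->//] : i = 0 \/ i = 1.
by case: i => [[|[|//]] lti]; [left|right]; apply/val_inj.
Qed.

Lemma sum2E (V : nmodType) (f : 'I_2 -> V) : \sum_i f i = f 0 + f 1.
Proof.
by rewrite big_ord_recl big_ord1; congr (_ + f _); apply/val_inj.
Qed.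

Lemma col2P x y : x 0 0 = y 0 0 -> x 1 0 = y 1 0 -> x = y.
Proof. by move=> h0 h1; apply/colP; exact: ord2P. Qed.

Lemma mulmx2E m p (A : 'M[R]_(m, 2)) (B : 'M[R]_(2, p)) i j :
  (A *m B) i j = A i 0 * B 0 j + A i 1 * B 1 j.
Proof. by rewrite mxE sum2E. Qed.

Lemma eucl_distE x y :
  eucl_dist x y = Num.sqrt ((x 0 0 - y 0 0) ^+ 2 + (x 1 0 - y 1 0) ^+ 2).
Proof. by rewrite /eucl_dist sum2E. Qed.

Lemma eucl_dist_le x y :
  eucl_dist x y <= `|x 0 0 - y 0 0| + `|x 1 0 - y 1 0|.
Proof.
rewrite eucl_distE -[leRHS]ger0_norm ?addr_ge0// -[leRHS]sqrtr_sqr ler_wsqrtr//.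
rewrite [leRHS]sqrrD !real_normK ?num_real// -addrA [X in _ <= _ + X]addrC addrA lerDl.
by rewrite mulrn_wge0// mulr_ge0.
Qed.

Lemma eucl_dist_coord x y i : `|x i 0 - y i 0| <= eucl_dist x y.
Proof.
rewrite eucl_distE -sqrtr_sqr ler_wsqrtr//.
by elim/ord2P: i; rewrite ?lerDl ?lerDr sqr_ge0.
Qed.

Lemma eucl_dist_sym x y : eucl_dist x y = eucl_dist y x.
Proof. by rewrite !eucl_distE -(sqrrN (x 0 0 - _)) -(sqrrN (x 1 0 - _)) !opprB. Qed.

Lemma eucl_dist0 x : eucl_dist x x = 0.
Proof. by rewrite eucl_distE !subrr expr0n/= addr0 sqrtr0. Qed.

Lemma eucl_dist_triangle x y z : eucl_dist x z <= eucl_dist x y + eucl_dist y z.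
Proof.
rewrite !eucl_distE.
set a := x 0 0 - y 0 0; set b := x 1 0 - y 1 0.
set c := y 0 0 - z 0 0; set e := y 1 0 - z 1 0.
have -> : x 0 0 - z 0 0 = a + c by rewrite /a /c; ring.
have -> : x 1 0 - z 1 0 = b + e by rewrite /b /e; ring.
have p1 : 0 <= a ^+ 2 + b ^+ 2 by rewrite addr_ge0 ?sqr_ge0.
have p2 : 0 <= c ^+ 2 + e ^+ 2 by rewrite addr_ge0 ?sqr_ge0.
rewrite -[leRHS]ger0_norm ?addr_ge0 ?sqrtr_ge0// -[leRHS]sqrtr_sqr ler_wsqrtr//.
rewrite [leRHS]sqrrD !sqr_sqrtr//.
(* Cauchy-Schwarz in the plane *)
have cs : a * c + b * e <= Num.sqrt (a ^+ 2 + b ^+ 2) * Num.sqrt (c ^+ 2 + e ^+ 2).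
  rewrite -sqrtrM// (le_trans (ler_norm _))// -sqrtr_sqr ler_wsqrtr//.
  have := sqr_ge0 (a * e - b * c); nra.
rewrite -subr_ge0 in cs; rewrite -subr_ge0 -mulr_natl; nra.
Qed.

(** A monomial matrix has one non-zero entry in every row and column. The maps
of type B are those for which the non-zero entries are off the diagonal. *)
Definition swaps A := A 0 0 == 0.

Definition monomial A :=
  if swaps A then [/\ A 1 1 = 0, A 0 1 != 0 & A 1 0 != 0]
  else [/\ A 0 1 = 0, A 1 0 = 0 & A 1 1 != 0].

(** The image of the unit square under a monomial matrix is a rectangle of this
width and height. *)
Definition mx_width A := `|A 0 0| + `|A 0 1|.
Definition mx_height A := `|A 1 0| + `|A 1 1|.

Variant monomial_spec A : bool -> R -> R -> Prop :=
| MonomialDiag : A 0 0 != 0 -> A 1 1 != 0 -> A 0 1 = 0 -> A 1 0 = 0 ->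
    monomial_spec A false `|A 0 0| `|A 1 1|
| MonomialSwap : A 0 1 != 0 -> A 1 0 != 0 -> A 0 0 = 0 -> A 1 1 = 0 ->
    monomial_spec A true `|A 0 1| `|A 1 0|.

Lemma monomialP A : monomial A -> monomial_spec A (swaps A) (mx_width A) (mx_height A).
Proof.
rewrite /monomial /mx_width /mx_height; have [A00 [A11 A01 A10]|A00 [A01 A10 A11]] := boolP (swaps A).
  rewrite (eqP A00) A11 normr0 add0r addr0.
  by constructor => //; apply/eqP.
by rewrite A01 A10 normr0 add0r addr0; constructor.
Qed.

Lemma monomial1 : [/\ monomial (1%:M : 'M[R]_2), swaps (1%:M : 'M[R]_2) = false,
  mx_width (1%:M : 'M[R]_2) = 1 & mx_height (1%:M : 'M[R]_2) = 1].
Proof.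
by rewrite /monomial /swaps /mx_width /mx_height !mxE/= oner_eq0 !mulr0n !normr0 normr1 addr0 add0r.
Qed.

Lemma monomialM A B : monomial A -> monomial B ->
  [/\ monomial (A *m B), swaps (A *m B) = swaps A (+) swaps B,
   mx_width (A *m B) = mx_width A * (if swaps A then mx_height B else mx_width B) &
   mx_height (A *m B) = mx_height A * (if swaps A then mx_width B else mx_height B)].
Proof.
move=> /monomialP[]a1 a2 a3 a4 /monomialP[]b1 b2 b3 b4;
  rewrite /monomial /swaps /mx_width /mx_height !mulmx2E a3 a4 b3 b4 !(mul0r, mulr0, addr0, add0r);
  by rewrite ?normrM ?eqxx !mulf_eq0 ?(negPf a1) ?(negPf a2) ?(negPf b1) ?(negPf b2) !(normr0, mul0r, mulr0, addr0, add0r) /=.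
Qed.

Lemma mx_width_gt0 A : monomial A -> 0 < mx_width A.
Proof. by move=> /monomialP[] *; rewrite normr_gt0. Qed.

Lemma mx_height_gt0 A : monomial A -> 0 < mx_height A.
Proof. by move=> /monomialP[] *; rewrite normr_gt0. Qed.

Lemma eigenvalue_diag2 A : A 0 1 = 0 -> A 1 0 = 0 ->
  [set a | eigenvalue A a] = [set A 0 0] `|` [set A 1 1].
Proof.
move=> A01 A10; apply/seteqP; split=> [a /= /eigenvalueP[v vA v0]|a /= h].
  have := congr1 (fun M : 'rV_2 => M 0 0) vA.
  have := congr1 (fun M : 'rV_2 => M 0 1) vA.
  rewrite !mulmx2E !mxE A01 A10 !mulr0 addr0 add0r => e1 e0.
  have [v00|v00] := eqVneq (v 0 0) 0.
    right; have v01 : v 0 1 != 0.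
      by apply: contra v0 => /eqP v01; apply/eqP/rowP; apply: ord2P; rewrite ?v00 ?v01 mxE.
    by apply: (mulfI v01); rewrite e1 mulrC.
  by left; apply: (mulfI v00); rewrite e0 mulrC.
apply/eigenvalueP; case: h => ->; [exists (delta_mx 0 0)|exists (delta_mx 0 1)].
- apply/rowP; apply: ord2P; rewrite mulmx2E !mxE/= ?A01 ?A10 ?mulr0n ?mulr1n; ring.
- by apply/negP => /eqP /rowP /(_ 0); rewrite !mxE/= => /eqP; rewrite oner_eq0.
- apply/rowP; apply: ord2P; rewrite mulmx2E !mxE/= ?A01 ?A10 ?mulr0n ?mulr1n; ring.
- by apply/negP => /eqP /rowP /(_ 1); rewrite !mxE/= => /eqP; rewrite oner_eq0.
Qed.

Lemma sup_set2 (a b : R) : sup ([set a] `|` [set b]) = Num.max a b.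
Proof.
wlog ab : a b / a <= b.
  move=> h; have /orP[/h//|/h ba] := le_total a b.
  by rewrite setUC ba maxC.
rewrite sup_setU; [by rewrite sup1; apply/esym/max_idPr|exact: has_sup1|].
by move=> x y /= -> ->.
Qed.

Lemma inf_set2 (a b : R) : inf ([set a] `|` [set b]) = Num.min a b.
Proof.
wlog ab : a b / a <= b.
  move=> h; have /orP[/h//|/h ba] := le_total a b.
  by rewrite setUC ba minC.
rewrite inf_setU; [by rewrite inf1; apply/esym/min_idPl|exact: has_inf1|].
by move=> x y /= -> ->.
Qed.

Lemma sqrt_max_sqr (a b : R) : Num.sqrt (Num.max (a ^+ 2) (b ^+ 2)) = Num.max `|a| `|b|.
Proof.
wlog ab : a b / `|a| <= `|b|.
  by move=> h; have /orP[/h//|/h E] := le_total `|a| `|b|; rewrite maxC E maxC.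
rewrite !max_r// -?sqrtr_sqr// -(real_normK (num_real a)) -(real_normK (num_real b)).
by rewrite lerXn2r.
Qed.

Lemma sqrt_min_sqr (a b : R) : Num.sqrt (Num.min (a ^+ 2) (b ^+ 2)) = Num.min `|a| `|b|.
Proof.
wlog ab : a b / `|a| <= `|b|.
  by move=> h; have /orP[/h//|/h E] := le_total `|a| `|b|; rewrite minC E minC.
rewrite !min_l// -?sqrtr_sqr// -(real_normK (num_real a)) -(real_normK (num_real b)).
by rewrite lerXn2r.
Qed.

(** The matrix A^T A is diagonal, with the squares of the entries of A as
eigenvalues. *)
Lemma alpha_monomial A : monomial A ->
  alpha1 A = Num.max (mx_width A) (mx_height A) /\ alpha2 A = Num.min (mx_width A) (mx_height A).
Proof.
move=> mA; rewrite /alpha1 /alpha2.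
have E : [set a | eigenvalue (A^T *m A) a] =
    [set (A^T *m A) 0 0] `|` [set (A^T *m A) 1 1].
  by apply: eigenvalue_diag2; rewrite mulmx2E !mxE;
    case: (monomialP mA) => _ _ -> ->; rewrite !(mul0r, mulr0, addr0, add0r).
rewrite E sup_set2 inf_set2 !mulmx2E !mxE -!expr2.
case: (monomialP mA) => _ _ -> ->; rewrite !expr0n/= ?addr0 ?add0r.
  by rewrite sqrt_max_sqr sqrt_min_sqr.
by rewrite maxC minC sqrt_max_sqr sqrt_min_sqr.
Qed.

End plane_coordinates.

Section lengths.
Context {R : realType}.
Implicit Types (A : 'M[R]_2) (t : 'cV[R]_2).

Lemma len_itv (J : set R) lo hi : J lo -> J hi ->
  (forall x, J x -> lo <= x <= hi) -> len J = hi - lo.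
Proof.
move=> Jlo Jhi h; rewrite /len; congr (_ - _).
  apply/eqP; rewrite eq_le; apply/andP; split.
    by apply: ge_sup; [exists lo|move=> x /h/andP[]].
  by apply: ub_le_sup => //; exists hi => x /h/andP[].
apply/eqP; rewrite eq_le; apply/andP; split.
  by apply: ge_inf => //; exists lo => x /h/andP[].
by apply: lb_le_inf; [exists lo|move=> x /h/andP[]].
Qed.

Lemma len_image_unit (i : 'I_2) A t (f : 'cV[R]_2 -> 'cV[R]_2) (pr : 'cV[R]_2 -> R) :
  (forall x, f x = A *m x + t) -> (forall x, pr x = x i 0) ->
  A i 0 = 0 \/ A i 1 = 0 ->
  len (pr @` (f @` @unit_square R)) = `|A i 0| + `|A i 1|.
Proof.
move=> fE prE Ai; set a := A i 0 + A i 1.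
have -> : `|A i 0| + `|A i 1| = `|a|.
  by rewrite /a; case: Ai => ->; rewrite normr0 ?addr0 ?add0r.
have J c : 0 <= c <= 1 -> (pr @` (f @` @unit_square R)) (a * c + t i 0).
  move=> c01; exists (f (const_mx c)).
    by exists (const_mx c) => // j; rewrite mxE.
  by rewrite prE fE mxE mulmx2E !mxE /a mulrDl.
have inJ x : (pr @` (f @` @unit_square R)) x ->
    exists2 c, 0 <= c <= 1 & x = a * c + t i 0.
  move=> [_ [y yu <-] <-]; rewrite prE fE mxE mulmx2E /a.
  by case: Ai => ->; rewrite mul0r ?addr0 ?add0r;
    [exists (y 1 0)|exists (y 0 0)].
have J0 := J 0; rewrite mulr0 lexx ler01 in J0.
have J1 := J 1; rewrite mulr1 lexx ler01 in J1.
have [a0|a0] := leP 0 a.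
  rewrite (@len_itv _ (0 + t i 0) (a + t i 0)); [|exact: J0|exact: J1|].
    by rewrite add0r addrK ger0_norm.
  by move=> x /inJ[c /andP[c0 c1] ->]; rewrite !lerD2r mulr_ge0// ler_piMr.
rewrite (@len_itv _ (a + t i 0) (0 + t i 0)); [|exact: J1|exact: J0|].
  by rewrite add0r opprD addrCA subrr addr0 ltr0_norm.
move=> x /inJ[c /andP[c0 c1] ->]; rewrite !lerD2r.
by apply/andP; split; nra.
Qed.

Lemma hline_neq_vline (c c' : R) : hline c <> Defs.vline c'.
Proof.
move=> E; have : hline c (vec2 (c' + 1) c) by rewrite /hline /pi2/= vec2_1.
rewrite E /Defs.vline /pi1/= vec2_0 => /eqP; rewrite -subr_eq0 addrAC subrr add0r.
by rewrite oner_eq0.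
Qed.

Lemma affine_typeA A t (f : 'cV[R]_2 -> 'cV[R]_2) :
  (forall x, f x = A *m x + t) -> monomial A -> ~~ swaps A -> typeA f.
Proof.
move=> fE mA nA c; exists (A 1 1 * c + t 1 0).
case: (monomialP mA) nA => // a1 a2 a3 a4 _.
apply/seteqP; split=> [_ [x <- <-]|y yc].
  by rewrite fE /hline /pi2/= mxE mulmx2E a4 mul0r add0r.
exists (vec2 ((y 0 0 - t 0 0) / A 0 0) c); first by rewrite /hline /pi2/= vec2_1.
apply: col2P; rewrite fE mxE mulmx2E vec2_0 vec2_1.
  by rewrite a3 mul0r addr0 mulrCA divff// mulr1 subrK.
by rewrite a4 mul0r add0r -yc.
Qed.

Lemma affine_typeB A t (f : 'cV[R]_2 -> 'cV[R]_2) :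
  (forall x, f x = A *m x + t) -> monomial A -> swaps A -> typeB f.
Proof.
move=> fE mA nA c; exists (A 0 1 * c + t 0 0).
case: (monomialP mA) nA => // a1 a2 a3 a4 _.
apply/seteqP; split=> [_ [x <- <-]|y yc].
  by rewrite fE /Defs.vline /pi1/= mxE mulmx2E a3 mul0r add0r.
exists (vec2 ((y 1 0 - t 1 0) / A 1 0) c); first by rewrite /hline /pi2/= vec2_1.
apply: col2P; rewrite fE mxE mulmx2E vec2_0 vec2_1.
  by rewrite a3 mul0r add0r -yc.
by rewrite a4 mul0r addr0 mulrCA divff// mulr1 subrK.
Qed.

Lemma typeA_typeB (f : 'cV[R]_2 -> 'cV[R]_2) : typeA f -> typeB f -> False.
Proof.
by move=> /(_ 0)[c e] /(_ 0)[c']; rewrite e; apply: hline_neq_vline.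
Qed.

End lengths.

(** * Words and the rectangles they define *)

Section finite_bounds.
Context {R : realType} {I : finType}.

Lemma finite_lower_bound (f : I -> R) : (forall i, 0 < f i) ->
  exists2 c, 0 < c <= 1 & forall i, c <= f i.
Proof.
move=> f0; suff [c c01 h] : exists2 c, 0 < c <= 1 & forall i, i \in enum I -> c <= f i.
  by exists c => // i; apply: h; rewrite mem_enum.
elim: (enum I) => [|i s [c /andP[c0 c1] h]]; first by exists 1 => //; rewrite ltr01 lexx.
exists (Num.min c (f i)); first by rewrite lt_min c0 f0/= ge_min c1.
by move=> j; rewrite inE ge_min => /orP[/eqP ->|/h ->//]; rewrite lexx orbT.
Qed.

End finite_bounds.

Section words.
Context {R : realType} {I : finType} (S : box_like_ifs R I).
Implicit Types (i : I) (u v w : seq I) (x y : 'cV[R]_2).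

(** The rows of the isometry have Euclidean norm at most one, because it maps
the corners (1, 1) and (1, -1) into the square; the columns have norm one. Hence
the rows have norm exactly one, and then the same corners show that the two
entries of a row have product zero. *)
Lemma iso_monomial i :
  [/\ monomial (iso S i), mx_width (iso S i) = 1 & mx_height (iso S i) = 1].
Proof.
set L := iso S i.
have col_norm a b : (L 0 0 * a + L 0 1 * b) ^+ 2 + (L 1 0 * a + L 1 1 * b) ^+ 2 = a ^+ 2 + b ^+ 2.
  have := iso_isometry S i (vec2 a b) 0.
  rewrite !eucl_distE mulmx0 !mulmx2E !vec2_0 !vec2_1 !mxE !subr0.
  move=> /(congr1 (fun z => z ^+ 2)); rewrite !sqr_sqrtr// addr_ge0 ?sqr_ge0//.
have corner b j : -1 <= b <= 1 -> -1 <= L j 0 + L j 1 * b <= 1.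
  move=> b1; have : (mulmx L @` @centred_square R) (L *m vec2 1 b).
    exists (vec2 1 b) => // k; elim/ord2P: k; rewrite ?vec2_0 ?vec2_1//.
    by apply/andP; split; lra.
  by rewrite (iso_square S i) => /(_ j); rewrite mulmx2E vec2_0 vec2_1 mulr1.
have c1 := col_norm 1 0; have c2 := col_norm 0 1.
rewrite !mulr0 !mulr1 !addr0 expr1n expr0n/= addr0 in c1.
rewrite !mulr0 !mulr1 !add0r expr1n expr0n/= add0r in c2.
have row_bound j : (L j 0 + L j 1) ^+ 2 <= 1 /\ (L j 0 - L j 1) ^+ 2 <= 1.
  have /andP[p1 p2] : -1 <= L j 0 + L j 1 * 1 <= 1 by apply: corner; rewrite lexx andbT; lra.
  have /andP[p3 p4] : -1 <= L j 0 + L j 1 * (-1) <= 1 by apply: corner; rewrite lexx /=; lra.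
  by split; nra.
have [r1 r2] := row_bound 0; have [r3 r4] := row_bound 1.
have z0 : L 0 0 * L 0 1 = 0 by nra.
have z1 : L 1 0 * L 1 1 = 0 by nra.
have n0 : L 0 0 ^+ 2 + L 0 1 ^+ 2 = 1 by nra.
have n1 : L 1 0 ^+ 2 + L 1 1 ^+ 2 = 1 by nra.
have norm1 (z : R) : z ^+ 2 = 1 -> `|z| = 1 /\ z != 0.
  move=> z21; split; first by rewrite -sqrtr_sqr z21 sqrtr1.
  by apply: contra_eq_neq z21 => ->; rewrite expr0n/= eq_sym oner_neq0.
rewrite /monomial /mx_width /mx_height /swaps; have [e|ne] := eqVneq (L 0 0) 0.
  rewrite e expr0n/= add0r in c1; rewrite e expr0n/= add0r in n0.
  have [h0 d0] := norm1 _ n0; have [h1 d1] := norm1 _ c1.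
  have L11 : L 1 1 = 0 by apply: (mulfI d1); rewrite z1 mulr0.
  by rewrite e L11 h0 h1 normr0 add0r addr0.
have L01 : L 0 1 = 0 by apply: (mulfI ne); rewrite z0 mulr0.
rewrite L01 expr0n/= add0r in c2; rewrite L01 expr0n/= addr0 in n0.
have [h0 d0] := norm1 _ n0; have [h1 d1] := norm1 _ c2.
have L10 : L 1 0 = 0 by apply: (mulIf d1); rewrite z1 mul0r.
by rewrite L01 L10 h0 h1 normr0 add0r addr0.
Qed.

Lemma lin_monomial i :
  [/\ monomial (lin S i), mx_width (lin S i) = scx S i & mx_height (lin S i) = scy S i].
Proof.
have /andP[a0 _] := scx_itv S i; have /andP[b0 _] := scy_itv S i.
have [mD sD wD hD] : [/\ monomial (diag_part S i), swaps (diag_part S i) = false,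
    mx_width (diag_part S i) = scx S i & mx_height (diag_part S i) = scy S i].
  rewrite /monomial /swaps /mx_width /mx_height !mxE/= !mulr0n !mulr1n.
  by rewrite !gt_eqF// normr0 addr0 add0r !gtr0_norm.
have [mL wL hL] := iso_monomial i.
have [m _ w h] := monomialM mD mL.
by rewrite /lin w h sD wL hL wD hD !mulr1.
Qed.

Definition base_len w := mx_width (word_lin S w).
Definition height_len w := mx_height (word_lin S w).
Definition is_typeB w := swaps (word_lin S w).

Lemma word_lin_cat u v : word_lin S (u ++ v) = word_lin S u *m word_lin S v.
Proof. by elim: u => [|i u IH] /=; rewrite ?mul1mx// IH mulmxA. Qed.

Lemma word_map_cat u v : word_map S (u ++ v) = word_map S u \o word_map S v.
Proof. by elim: u => [|i u IH] //=; rewrite IH. Qed.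

Lemma word_lin_monomial w : monomial (word_lin S w).
Proof.
elim: w => [|i w IH] /=; first by case: (@monomial1 R).
by have [mi _ _] := lin_monomial i; have [] := monomialM mi IH.
Qed.

Lemma base_len_nil : base_len [::] = 1. Proof. by have [] := @monomial1 R. Qed.
Lemma height_len_nil : height_len [::] = 1. Proof. by have [] := @monomial1 R. Qed.
Lemma is_typeB_nil : is_typeB [::] = false. Proof. by have [] := @monomial1 R. Qed.

Lemma is_typeB_cat u v : is_typeB (u ++ v) = is_typeB u (+) is_typeB v.
Proof.
rewrite /is_typeB word_lin_cat.
by have [] := monomialM (word_lin_monomial u) (word_lin_monomial v).
Qed.

Lemma base_len_cat u v :
  base_len (u ++ v) = base_len u * (if is_typeB u then height_len v else base_len v).
Proof.
rewrite /base_len word_lin_cat.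
by have [_ _ -> _] := monomialM (word_lin_monomial u) (word_lin_monomial v).
Qed.

Lemma height_len_cat u v :
  height_len (u ++ v) = height_len u * (if is_typeB u then base_len v else height_len v).
Proof.
rewrite /height_len word_lin_cat.
by have [_ _ _ ->] := monomialM (word_lin_monomial u) (word_lin_monomial v).
Qed.

Lemma base_len1 i : base_len [:: i] = scx S i.
Proof. by rewrite /base_len /= mulmx1; have [] := lin_monomial i. Qed.

Lemma height_len1 i : height_len [:: i] = scy S i.
Proof. by rewrite /height_len /= mulmx1; have [] := lin_monomial i. Qed.

Lemma base_len_gt0 w : 0 < base_len w.
Proof. exact/mx_width_gt0/word_lin_monomial. Qed.

Lemma height_len_gt0 w : 0 < height_len w.
Proof. exact/mx_height_gt0/word_lin_monomial. Qed.

Definition long_side w := Num.max (base_len w) (height_len w).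
Definition short_side w := Num.min (base_len w) (height_len w).

Lemma short_side_gt0 w : 0 < short_side w.
Proof. by rewrite lt_min base_len_gt0 height_len_gt0. Qed.

Lemma long_side_gt0 w : 0 < long_side w.
Proof. by rewrite lt_max base_len_gt0. Qed.

Lemma short_le_long w : short_side w <= long_side w.
Proof. by rewrite ge_min /long_side !le_max lexx. Qed.

Lemma short_side_nil : short_side [::] = 1.
Proof. by rewrite /short_side base_len_nil height_len_nil minxx. Qed.

Lemma alpha1_word w : alpha1 (word_lin S w) = long_side w.
Proof. by have [] := alpha_monomial (word_lin_monomial w). Qed.

Lemma alpha2_word w : alpha2 (word_lin S w) = short_side w.
Proof. by have [] := alpha_monomial (word_lin_monomial w). Qed.

Lemma word_lin_row0 w : word_lin S w 0 0 = 0 \/ word_lin S w 0 1 = 0.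
Proof. by case: (monomialP (word_lin_monomial w)) => _ _; [right|left]. Qed.

Lemma word_lin_row1 w : word_lin S w 1 0 = 0 \/ word_lin S w 1 1 = 0.
Proof. by case: (monomialP (word_lin_monomial w)) => _ _ *; [left|right]. Qed.

Lemma baseE w : base S w = base_len w.
Proof.
apply: (@len_image_unit _ 0 (word_lin S w) (word_map S w 0)) => // [x|].
  exact: word_mapE.
exact: word_lin_row0.
Qed.

Lemma heightE w : height S w = height_len w.
Proof.
apply: (@len_image_unit _ 1 (word_lin S w) (word_map S w 0)) => // [x|].
  exact: word_mapE.
exact: word_lin_row1.
Qed.

Definition proj_horizontal w :=
  if is_typeB w then base_len w < height_len w else height_len w <= base_len w.

Lemma proj_is_pi1E w : proj_is_pi1 S w <-> proj_horizontal w.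
Proof.
rewrite /proj_is_pi1 /proj_horizontal baseE heightE.
have fE := word_mapE S w; have mA := word_lin_monomial w.
have [tB|tA] := boolP (is_typeB w).
  have B := affine_typeB fE mA tB.
  by split=> [[[A _]|[]//]|h]; [case: (typeA_typeB A B)|right].
have A := affine_typeA fE mA tA.
by split=> [[[]//|[B _]]|h]; [case: (typeA_typeB A B)|left].
Qed.

Lemma word_dimE (s1 s2 : R) w :
  word_dim S s1 s2 w = if proj_horizontal w then s1 else s2.
Proof.
rewrite /word_dim; case: asboolP => [/proj_is_pi1E ->//|np].
by case: ifPn => // /proj_is_pi1E.
Qed.

Lemma psiE (s1 s2 s : R) w : psi S s1 s2 s w =
  long_side w `^ word_dim S s1 s2 w * short_side w `^ (s - word_dim S s1 s2 w).
Proof. by rewrite /psi alpha1_word alpha2_word. Qed.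

Lemma psi_gt0 (s1 s2 s : R) w : 0 < psi S s1 s2 s w.
Proof. by rewrite psiE mulr_gt0// powR_gt0// ?long_side_gt0 ?short_side_gt0. Qed.

Lemma word_map_dist0 w x y :
  `|word_map S w x 0 0 - word_map S w y 0 0| =
  base_len w * `|if is_typeB w then x 1 0 - y 1 0 else x 0 0 - y 0 0|.
Proof.
rewrite /base_len /is_typeB (word_mapE S w x) (word_mapE S w y) !mxE !sum2E opprD addrACA subrr addr0.
case: (monomialP (word_lin_monomial w)) => _ _ e1 e2.
  by rewrite e1 !mul0r !addr0 -mulrBr normrM.
by rewrite e1 !mul0r !add0r -mulrBr normrM.
Qed.

Lemma word_map_dist1 w x y :
  `|word_map S w x 1 0 - word_map S w y 1 0| =
  height_len w * `|if is_typeB w then x 0 0 - y 0 0 else x 1 0 - y 1 0|.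
Proof.
rewrite /height_len /is_typeB (word_mapE S w x) (word_mapE S w y) !mxE !sum2E opprD addrACA subrr addr0.
case: (monomialP (word_lin_monomial w)) => _ _ e1 e2.
  by rewrite e2 !mul0r !add0r -mulrBr normrM.
by rewrite e2 !mul0r !addr0 -mulrBr normrM.
Qed.

Lemma contraction_bounds :
  exists c C : R, [/\ 0 < c <= 1 /\ 0 < C < 1,
    forall w, c ^+ size w <= short_side w,
    forall w, long_side w <= C ^+ size w,
    forall u v, base_len (u ++ v) <= base_len u /\ height_len (u ++ v) <= height_len u &
    forall w i, c * short_side w <= short_side (rcons w i)].
Proof.
have sx0 i : 0 < scx S i by have /andP[] := scx_itv S i.
have sx1 i : 0 < 1 - scx S i by rewrite subr_gt0; have /andP[] := scx_itv S i.
have sy0 i : 0 < scy S i by have /andP[] := scy_itv S i.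
have sy1 i : 0 < 1 - scy S i by rewrite subr_gt0; have /andP[] := scy_itv S i.
have [c1 /andP[c10 c11] h1] := finite_lower_bound sx0.
have [c2 /andP[c20 c21] h2] := finite_lower_bound sy0.
have [d1 /andP[d10 d11] k1] := finite_lower_bound sx1.
have [d2 /andP[d20 d21] k2] := finite_lower_bound sy1.
set c := Num.min c1 c2; set C := Num.max (1 / 2) (1 - Num.min d1 d2).
have c0 : 0 < c by rewrite lt_min c10.
have C0 : 0 < C by rewrite lt_max divr_gt0.
have C1 : C < 1 by rewrite gt_max ltr_pdivrMr// mul1r ltr1n/= ltrBlDr ltrDl lt_min d10.
have cx i : c <= scx S i by rewrite ge_min h1.
have cy i : c <= scy S i by rewrite ge_min h2 orbT.
have xC i : scx S i <= C.
  by rewrite le_max; apply/orP; right; rewrite lerBrDr -lerBrDl ge_min k1.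
have yC i : scy S i <= C.
  by rewrite le_max; apply/orP; right; rewrite lerBrDr -lerBrDl ge_min k2 orbT.
have low w : c ^+ size w <= base_len w /\ c ^+ size w <= height_len w.
  elim: w => [|i w [IH1 IH2]] /=; first by rewrite base_len_nil height_len_nil expr0.
  rewrite exprS -cat1s base_len_cat height_len_cat base_len1 height_len1.
  have cw : 0 <= c ^+ size w by rewrite exprn_ge0// ltW.
  by split; apply: ler_pM => //; rewrite ?(ltW c0)//; case: ifP.
have upp w : base_len w <= C ^+ size w /\ height_len w <= C ^+ size w.
  elim: w => [|i w [IH1 IH2]] /=; first by rewrite base_len_nil height_len_nil expr0.
  rewrite exprS -cat1s base_len_cat height_len_cat base_len1 height_len1.
  by split; apply: ler_pM => //; rewrite ?(ltW (sx0 _)) ?(ltW (sy0 _))//; case: ifP => //;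
    rewrite ltW ?base_len_gt0 ?height_len_gt0.
have le1 w : base_len w <= 1 /\ height_len w <= 1.
  have [u1 u2] := upp w; have e : C ^+ size w <= 1 by rewrite exprn_ile1// ltW.
  by split; [exact: le_trans u1 e|exact: le_trans u2 e].
exists c, C; split.
- by rewrite c0/= ge_min c11 C0.
- by move=> w; have [] := low w; rewrite le_min => -> ->.
- by move=> w; have [] := upp w; rewrite ge_max => -> ->.
- move=> u v; rewrite base_len_cat height_len_cat; have [v1 v2] := le1 v.
  by split; rewrite ler_piMr ?(ltW (base_len_gt0 _)) ?(ltW (height_len_gt0 _))//; case: ifP.
move=> w i; rewrite -cats1 /short_side base_len_cat height_len_cat base_len1 height_len1.
rewrite le_min; apply/andP; split; rewrite mulrC.
  apply: ler_pM; rewrite ?(ltW c0) ?(ltW (short_side_gt0 _))//; last by case: ifP.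
  by rewrite ge_min lexx.
apply: ler_pM; rewrite ?(ltW c0) ?(ltW (short_side_gt0 _))//; last by case: ifP.
by rewrite ge_min lexx orbT.
Qed.

End words.

(** * Sums over words and stopping sets *)

Section word_lists.
Context {I : finType}.
Implicit Types (u v w : seq I).

Definition words (k : nat) : seq (seq I) := [seq val t | t <- enum {: k.-tuple I}].

Lemma mem_words k w : (w \in words k) = (size w == k).
Proof.
apply/mapP/eqP => [[t _ ->]|<-]; first exact: size_tuple.
by exists (in_tuple w); rewrite ?mem_enum.
Qed.

Lemma words_uniq k : uniq (words k).
Proof. by rewrite map_inj_uniq ?enum_uniq//; exact: val_inj. Qed.

Lemma big_words (V : nmodType) k (f : seq I -> V) :
  \sum_(w <- words k) f w = \sum_(t : k.-tuple I) f t.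
Proof. by rewrite big_map big_enum. Qed.

Lemma sum_words_cat (V : nmodType) j l (f : seq I -> V) :
  \sum_(w <- words (j + l)) f w = \sum_(u <- words j) \sum_(v <- words l) f (u ++ v).
Proof.
rewrite (perm_big [seq u ++ v | u <- words j, v <- words l]).
  by rewrite /= big_allpairs_dep.
apply: uniq_perm; first exact: words_uniq.
  apply: allpairs_uniq; [exact: words_uniq|exact: words_uniq|].
  move=> [u v] [u' v'] /allpairsP[[a b] /= [+ _ [-> ->]]] /allpairsP[[a' b'] /= [+ _ [-> ->]]].
  rewrite !mem_words => /eqP sa /eqP sa' /eqP /=.
  by rewrite eqseq_cat ?sa ?sa'// => /andP[/eqP -> /eqP ->].
move=> w; rewrite mem_words; apply/eqP/allpairsP => [sw|[[u v] /= [+ + ->]]].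
  exists (take j w, drop j w); split=> /=; last by rewrite cat_take_drop.
    by rewrite mem_words size_takel ?sw ?leq_addr.
  by rewrite mem_words size_drop sw addKn.
by rewrite !mem_words size_cat => /eqP -> /eqP ->.
Qed.

(** With h the length of the shorter side, these are the words whose rectangles
have a shorter side comparable to r; no one of them extends another. *)
Definition stopped {R : realType} (h : seq I -> R) (r : R) w :=
  [&& (0 < size w)%N, h w <= r & r < h (take (size w).-1 w)].

Definition stopping_set {R : realType} (h : seq I -> R) (r : R) (K : nat) : seq (seq I) :=
  [seq w <- flatten [seq words k | k <- iota 0 K.+1] | stopped h r w].

Section stopping.
Context {R : realType} (h : seq I -> R) (r : R) (K : nat).
Hypothesis h_cat : forall u v, h (u ++ v) <= h u.

Lemma mem_stopping_set w :
  (w \in stopping_set h r K) = stopped h r w && (size w <= K)%N.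
Proof.
rewrite mem_filter; congr (_ && _); apply/flattenP/idP.
  by move=> [_ /mapP[k + ->]]; rewrite mem_iota add0n ltnS mem_words => /andP[_ +] /eqP ->.
move=> wK; exists (words (size w)); last by rewrite mem_words.
by apply/mapP; exists (size w) => //; rewrite mem_iota.
Qed.

Lemma stopping_set_uniq : uniq (stopping_set h r K).
Proof.
rewrite filter_uniq//.
have -> : flatten [seq words k | k <- iota 0 K.+1] = [seq w | k <- iota 0 K.+1, w <- words k].
  by congr flatten; apply: eq_map => k; rewrite map_id.
apply: allpairs_uniq_dep; [exact: iota_uniq|by move=> k _; exact: words_uniq|].
move=> [k w] [k' w'] /allpairsPdep[a [b [_ + [-> ->]]]] /allpairsPdep[a' [b' [_ + [-> ->]]]] /=.
by rewrite !mem_words => /eqP <- /eqP <- ->.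
Qed.

Lemma stopping_set_antichain : {in stopping_set h r K &, forall u v, prefix u v -> u = v}.
Proof.
move=> u v; rewrite !mem_stopping_set => /andP[/and3P[_ hu _] _] /andP[/and3P[v0 _ hv] _].
move=> /prefixP[t vE]; case/lastP: t vE => [->|t a vE]; first by rewrite cats0.
move: hv; rewrite vE -rcons_cat size_rcons/= -cats1 take_size_cat//.
by move=> /(le_lt_trans (le_trans (h_cat u t) hu)); rewrite ltxx.
Qed.

Lemma stopping_prefix w : r < h [::] -> h w <= r -> (size w <= K)%N ->
  exists2 j, (j <= size w)%N & take j w \in stopping_set h r K.
Proof.
move=> h0 hw wK.
have ex : exists j, h (take j w) <= r by exists (size w); rewrite take_size.
case: (ex_minnP ex) => j hj jmin.
have jw : (j <= size w)%N by apply: jmin; rewrite take_size.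
have j0 : (0 < j)%N by case: j hj {jmin jw} => //; rewrite take0 leNgt h0.
exists j => //; rewrite mem_stopping_set /stopped size_takel// j0 hj/=.
rewrite (leq_trans jw wK) andbT ltNge take_takel ?leq_pred//.
by apply/negP => /jmin; rewrite leqNgt ltn_predL j0.
Qed.

Lemma sum_stopping_set_le (f : seq I -> R) : (forall w, 0 <= f w) ->
  \sum_(w <- stopping_set h r K) f w <= \sum_(k < K.+1) \sum_(w <- words k) f w.
Proof.
move=> f0; rewrite big_filter big_mkcond big_flatten big_map.
rewrite -[iota 0 K.+1]/(index_iota 0 K.+1) big_mkord.
by apply: ler_sum => k _; apply: ler_sum => w _; case: ifP.
Qed.

(** Every long word starts with a word of the stopping set, so submultiplicativity
bounds the sum over the words of length k by a combination of the sums over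
shorter words, with non-negative weights of total at most one. *)
Lemma submultiplicative_bounded (f : seq I -> R) :
  (forall w, 0 <= f w) -> (forall u v, f (u ++ v) <= f u * f v) ->
  r < h [::] -> (forall w, size w = K -> h w <= r) ->
  \sum_(w <- stopping_set h r K) f w <= 1 ->
  exists B, forall k, \sum_(w <- words k) f w <= B.
Proof.
move=> f0 fM h0 hK sum1; pose g k := \sum_(w <- words k) f w.
have g0 k : 0 <= g k by apply: sumr_ge0.
exists (\sum_(j < K.+1) g j) => k; elim/ltn_ind: k => k IH.
have [kK|Kk] := leqP k K.
  by rewrite (bigD1 (Ordinal (kK : k < K.+1)%N))//= lerDl sumr_ge0.
set B := \sum_(j < K.+1) g j in IH *.
have step w : w \in words k -> f w <=
    \sum_(j < K.+1) (if stopped h r (take j w) then f (take j w) * f (drop j w) else 0).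
  rewrite mem_words => /eqP wk.
  have hw : h (take K w) <= r by apply: hK; rewrite size_takel// wk ltnW.
  have sK : size (take K w) = K by rewrite size_takel// wk ltnW.
  have [|j] := stopping_prefix h0 hw; rewrite sK// => jK.
  rewrite take_takel// mem_stopping_set => /andP[st _].
  rewrite (bigD1 (Ordinal (jK : j < K.+1)%N))//= st -{1}(cat_take_drop j w).
  by rewrite -[leLHS]addr0 lerD// sumr_ge0// => i _; case: ifP => // _; rewrite mulr_ge0.
apply: (@le_trans _ _ (\sum_(w <- words k) \sum_(j < K.+1)
   (if stopped h r (take j w) then f (take j w) * f (drop j w) else 0))).
  by rewrite big_seq [leRHS]big_seq; apply: ler_sum.
rewrite exchange_big/=.
apply: (@le_trans _ _ (\sum_(j < K.+1) \sum_(u <- words j | stopped h r u) f u * B)); last first.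
  under eq_bigr => j _ do rewrite -mulr_suml.
  rewrite -mulr_suml -[leRHS]mul1r ler_wpM2r ?sumr_ge0//.
  apply: le_trans sum1; rewrite big_filter big_flatten big_map.
  by rewrite -[iota 0 K.+1]/(index_iota 0 K.+1) big_mkord.
apply: ler_sum => j _; have jk : (j < k)%N by apply: leq_ltn_trans Kk; rewrite -ltnS.
rewrite -(subnKC (ltnW jk)) sum_words_cat [leRHS]big_mkcond/= big_seq [leRHS]big_seq.
apply: ler_sum => u; rewrite mem_words => /eqP uj.
under eq_bigr => v _ do rewrite take_size_cat// drop_size_cat//.
have [st|_] := ifP; last by rewrite big1.
rewrite -mulr_sumr ler_wpM2l//; have [j0|j0] := posnP j.
  by move: st; rewrite /stopped uj j0.
by apply: IH; rewrite ltn_subrL j0 (leq_ltn_trans _ jk).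
Qed.

End stopping.
End word_lists.

(** * Cylinders of the attractor *)

Section cylinders.
Context {R : realType} {I : finType} (S : box_like_ifs R I).
Context (F : set 'cV[R]_2) (attractorF : is_attractor S F).
Implicit Types (w : seq I) (x y : 'cV[R]_2).

Definition word_proj w x : R := if proj_horizontal S w then x 0 0 else x 1 0.

(** This is what the choice of projection is made for: along its longer side a
cylinder looks like the projection attached to the word, and along its shorter
side like the other projection. *)
Lemma word_map_sides w :
  exists j k l : 'I_2, [/\ j = 0 /\ k = 1 \/ j = 1 /\ k = 0,
    forall x y, `|word_map S w x j 0 - word_map S w y j 0| =
                long_side S w * `|word_proj w x - word_proj w y| &
    forall x y, `|word_map S w x k 0 - word_map S w y k 0| =
                short_side S w * `|x l 0 - y l 0| ].
Proof.
have d0 := word_map_dist0 S w; have d1 := word_map_dist1 S w.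
rewrite /word_proj /proj_horizontal /long_side /short_side.
have [bh|hb] := ltP (base_len S w) (height_len S w).
- exists 1, 0, (if is_typeB S w then 1 else 0); split; first by right.
  + by move=> x y; rewrite d1; case: (is_typeB S w).
  + by move=> x y; rewrite d0; case: (is_typeB S w).
- exists 0, 1, (if is_typeB S w then 0 else 1); split; first by left.
  + by move=> x y; rewrite d0; case: (is_typeB S w).
  + by move=> x y; rewrite d1; case: (is_typeB S w).
Qed.

Lemma attractor_bounded :
  exists2 D : R, 0 < D & forall x y i, F x -> F y -> `|x i 0 - y i 0| <= D.
Proof.
have [_ cF _] := attractorF.
have [M M0 hM] := ex_strict_bound_gt0 (compact_bounded cF).
exists (2 * M + 1); first by rewrite ltr_wpDl// mulr_ge0// ltW.
move=> x y i Fx Fy; rewrite (le_trans (ler_normB _ _))//.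
have coord z : F z -> `|z i 0| <= M.
  move=> Fz; apply: le_trans (ltW (hM z Fz)).
  rewrite /Num.norm/= mx_normrE.
  exact: (le_bigmax _ (fun ij : 'I_2 * 'I_1 => `|z ij.1 ij.2|) (i, ord0)).
by rewrite ler_wpDr// mulr2n mulrDl mul1r lerD// coord.
Qed.

Lemma word_map_attractor w x : F x -> F (word_map S w x).
Proof.
have [_ _ FE] := attractorF.
by elim: w => //= i w IH /IH h; rewrite FE; exists i => //; exists (word_map S w x).
Qed.

Lemma attractor_words k x : F x ->
  exists2 w, size w = k & (word_map S w @` F) x.
Proof.
have [_ _ FE] := attractorF.
elim: k x => [|k IH] x Fx; first by exists [::] => //; exists x.
have : (\bigcup_i (smap S i @` F)) x by rewrite -FE.
move=> [i _ [y /IH [w wk [z Fz <-]] <-]].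
by exists (i :: w); rewrite /= ?wk//; exists z.
Qed.

Lemma covered_cylinder w r D n :
  (forall x y i, F x -> F y -> `|x i 0 - y i 0| <= D) ->
  covered (@real_dist R) (word_proj w @` F) r n ->
  covered (@eucl_dist R) (word_map S w @` F) (long_side S w * r + short_side S w * D) n.
Proof.
move=> hD [U [cU dU]]; have [j [k [l [jk dj dk]]]] := word_map_sides w.
exists (fun i => [set z | exists2 x, F x & z = word_map S w x /\ U i (word_proj w x)]); split.
  move=> _ [x Fx <-]; have [|i _ Ui] := cU (word_proj w x); first by exists x.
  by exists i => //; exists x.
move=> i _ _ [x Fx [-> Ux]] [y Fy [-> Uy]].
have hj : `|word_map S w x j 0 - word_map S w y j 0| <= long_side S w * r.
  by rewrite dj ler_wpM2l ?(ltW (long_side_gt0 _ _))//; apply: dU Ux Uy.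
have hk : `|word_map S w x k 0 - word_map S w y k 0| <= short_side S w * D.
  by rewrite dk ler_wpM2l ?(ltW (short_side_gt0 _ _))// hD.
apply: le_trans (eucl_dist_le _ _) _.
by case: jk hj hk => -[-> ->] hj hk; [exact: lerD|rewrite addrC; exact: lerD].
Qed.

Lemma covered_cylinder_proj w r n :
  covered (@eucl_dist R) (word_map S w @` F) (long_side S w * r) n ->
  covered (@real_dist R) (word_proj w @` F) r n.
Proof.
move=> [U [cU dU]]; have [j [k [l [jk dj dk]]]] := word_map_sides w.
exists (fun i => [set p | exists2 x, F x & p = word_proj w x /\ U i (word_map S w x)]); split.
  move=> _ [x Fx <-]; have [|i _ Ui] := cU (word_map S w x); first by exists x.
  by exists i => //; exists x.
move=> i _ _ [x Fx [-> Ux]] [y Fy [-> Uy]].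
rewrite /real_dist -(ler_pM2l (long_side_gt0 S w)) -dj.
exact: le_trans (eucl_dist_coord _ _ _) (dU i _ _ Ux Uy).
Qed.

Lemma short_side_cat u v : short_side S (u ++ v) <= short_side S u.
Proof.
have [c [C [_ _ _ h _]]] := contraction_bounds S; have [hb hh] := h u v.
by rewrite /short_side le_min !ge_min hb hh orbT.
Qed.

(** Follow the coding of a point until the shorter side drops below r. *)
Lemma attractor_stopping_set r C K :
  (forall w, long_side S w <= C ^+ size w) -> C ^+ K <= r -> r < 1 ->
  F `<=` [set x | exists2 w, w \in stopping_set (short_side S) r K & (word_map S w @` F) x].
Proof.
move=> hC CK r1 x Fx; have [w wK [y Fy <-]] := attractor_words K Fx.
have sw : short_side S w <= r.
  by apply: le_trans (short_le_long _ _) _; apply: le_trans (hC w) _; rewrite wK.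
have [|||j _ jst] := @stopping_prefix _ _ (short_side S) r K w.
- by rewrite short_side_nil.
- by [].
- by rewrite wK.
exists (take j w) => //; exists (word_map S (drop j w) y); first exact: word_map_attractor.
by rewrite -[LHS]/((word_map S (take j w) \o word_map S (drop j w)) y) -word_map_cat cat_take_drop.
Qed.

Lemma stopped_short_side c r w :
  (forall w i, c * short_side S w <= short_side S (rcons w i)) -> 0 < c ->
  stopped (short_side S) r w -> c * r <= short_side S w <= r.
Proof.
move=> hc c0 /and3P[w0 -> rw]; rewrite andbT.
case/lastP: w w0 rw => // w i _; rewrite size_rcons/= -cats1 take_size_cat// cats1 => rw.
by apply: le_trans (hc w i); rewrite ler_wpM2l// ltW.
Qed.

End cylinders.

Section scale_comparison.
Context {R : realType}.
Implicit Types (a b c r p t e : R).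

(** On a stopping set the shorter side b of a cylinder is comparable to the
scale r. Covering a cylinder with longer side a at scale r amounts to covering a
projection at scale r / a, and this lemma and the next one compare the resulting
power of r / a with the modified singular value times a power of r. *)
Lemma scale_le c t p : 0 < c -> exists2 K, 0 < K & forall a b r e,
  0 < r -> c * r <= b -> b <= r -> 0 < a -> a <= 1 -> 0 <= e ->
  (r / a) `^ (- (p + e)) <= K * (a `^ p * b `^ (t - p)) * r `^ (- (t + e)).
Proof.
move=> c0; exists (1 `^ (- (t - p)) + c `^ (- (t - p))).
  by rewrite ltr_wpDr ?powR_ge0// powR_gt0.
move=> a b r e r0 cb br a0 a1 e0; have b0 : 0 < b by apply: lt_le_trans cb; rewrite mulr_gt0.
set K := 1 `^ _ + _.
have K0 : 0 < K by rewrite ltr_wpDr ?powR_ge0// powR_gt0.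
have ra0 : 0 < r / a by rewrite divr_gt0.
have -> : (r / a) `^ (- (p + e)) = r `^ (- (p + e)) * a `^ (p + e).
  by rewrite powRM ?invr_ge0 ?ltW// -powR_inv1 ?ltW// -powRrM mulrNN mul1r.
have step1 : a `^ (p + e) <= a `^ p.
  by rewrite powRDp// ler_piMr ?powR_ge0// powR_le1// a0.
have step2 : r `^ (t - p) <= K * b `^ (t - p).
  have -> : r = (b / r)^-1 * b by rewrite invf_div mulrVK ?unitfE ?gt_eqF.
  have br0 : 0 <= b / r by rewrite divr_ge0 ?(ltW b0) ?(ltW r0).
  rewrite powRM ?invr_ge0 ?(ltW b0)// ler_wpM2r ?powR_ge0//.
  rewrite -powR_inv1// -powRrM mulN1r /K [leRHS]addrC.
  apply: powR_itv_le => //; first by rewrite ler_pdivlMr.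
  by rewrite ler_pdivrMr// mul1r.
have -> : r `^ (- (p + e)) = r `^ (- (t + e)) * r `^ (t - p).
  by rewrite -powRDp//; congr (_ `^ _); ring.
rewrite [leRHS]mulrC -mulrA ler_wpM2l ?powR_ge0//.
rewrite [leLHS]mulrC mulrCA ler_pM ?powR_ge0//.
Qed.

Lemma scale_ge c t p : 0 < c -> exists2 K, 0 < K & forall a b r e,
  0 < r -> c * r <= b -> b <= r -> 0 < a -> a <= 1 -> 0 <= e ->
  K * (a `^ p * b `^ (t - p)) * r `^ (- (t - e)) <= (r / a) `^ (- (p - e)).
Proof.
move=> c0; set K := c `^ (t - p) + 1 `^ (t - p).
have K0 : 0 < K by rewrite ltr_wpDl ?powR_ge0// powR_gt0.
exists K^-1; first by rewrite invr_gt0.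
move=> a b r e r0 cb br a0 a1 e0; have b0 : 0 < b by apply: lt_le_trans cb; rewrite mulr_gt0.
have -> : (r / a) `^ (- (p - e)) = r `^ (- (p - e)) * a `^ (p - e).
  by rewrite powRM ?invr_ge0 ?ltW// -powR_inv1 ?ltW// -powRrM mulrNN mul1r.
have step1 : a `^ p <= a `^ (p - e).
  by rewrite ger_powR ?a0// lerBlDr lerDl.
have step2 : K^-1 * b `^ (t - p) <= r `^ (t - p).
  have -> : b = (b / r) * r by rewrite mulrVK ?unitfE ?gt_eqF.
  have br0 : 0 <= b / r by rewrite divr_ge0 ?(ltW b0) ?(ltW r0).
  rewrite powRM ?(ltW r0)// mulrA -[leRHS]mul1r ler_wpM2r ?powR_ge0//.
  rewrite mulrC ler_pdivrMr// mul1r.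
  apply: powR_itv_le => //; first by rewrite ler_pdivlMr.
  by rewrite ler_pdivrMr// mul1r.
have -> : r `^ (- (p - e)) = r `^ (- (t - e)) * r `^ (t - p).
  by rewrite -powRDp//; congr (_ `^ _); ring.
rewrite [leLHS]mulrC -[leRHS]mulrA ler_wpM2l ?powR_ge0//.
by rewrite [leRHS]mulrC mulrCA ler_pM ?mulr_ge0 ?invr_ge0 ?powR_ge0 ?(ltW K0).
Qed.

End scale_comparison.

(** * Growth of the sums of modified singular values *)

Section pressure.
Context {R : realType} {I : finType} (S : box_like_ifs R I) (s1 s2 : R).
Implicit Types (s t : R) (k : nat).

Local Notation Psi := (Psi S s1 s2).
Local Notation psi := (psi S s1 s2).

Lemma PsiE s k : Psi s k = \sum_(w <- words k) psi s w.
Proof. by rewrite big_words. Qed.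

Lemma Psi_ge0 s k : 0 <= Psi s k.
Proof. by apply: sumr_ge0 => w _; apply/ltW/psi_gt0. Qed.

(** A divergent sequence has limit 0 by convention, so P s = 1 contains the
convergence of the roots. *)
Lemma Psi_root_bounds s (e : R) : P S s1 s2 s = 1 -> 0 < e < 1 ->
  exists N, forall k, (N <= k)%N -> (1 - e) ^+ k <= Psi s k <= (1 + e) ^+ k.
Proof.
move=> Ps /andP[e0 e1].
have cv : Psi s k `^ k%:R^-1 @[k --> \oo] --> (1 : R).
  have : cvg (Psi s k `^ k%:R^-1 @[k --> \oo]).
    apply: contrapT => /dvgP E; move: Ps; rewrite /P E => /eqP.
    by rewrite eq_sym oner_eq0.
  move=> h; have E : lim (Psi s k `^ k%:R^-1 @[k --> \oo]) = 1 by [].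
  by move: h; rewrite E.
move/cvgrPdist_lt: cv => /(_ e e0) [N _ hN].
exists N.+1 => k Nk; have k0 : (0 < k)%N by apply: leq_trans Nk.
have := hN k (ltnW Nk); rewrite /= ltr_distlC => /andP[lo hi].
have -> : Psi s k = (Psi s k `^ k%:R^-1) ^+ k.
  rewrite -powR_mulrn ?powR_ge0// -powRrM mulVf ?powRr1 ?Psi_ge0//.
  by rewrite pnatr_eq0 -lt0n.
apply/andP; split; apply: lerXn2r; rewrite ?nnegrE ?powR_ge0 ?(ltW lo) ?(ltW hi)//; lra.
Qed.

Lemma psi_shift s t w : psi t w = psi s w * short_side S w `^ (t - s).
Proof.
rewrite !psiE -mulrA -powRDp ?short_side_gt0//; congr (_ * _ `^ _); ring.
Qed.

(** Raising the exponent multiplies each term by a power of a shorter side, which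
decreases geometrically in the length of the word. *)
Lemma Psi_shift s t : s < t -> exists2 th : R, 0 < th < 1 &
  forall k, Psi t k <= th ^+ k * Psi s k.
Proof.
move=> st; have [c [C [[_ /andP[C0 C1]] _ hC _ _]]] := contraction_bounds S.
have th0 : 0 < C `^ (t - s) by rewrite powR_gt0.
exists (C `^ (t - s)).
  by rewrite th0/= powR_exp// expR_lt1 pmulr_rlt0 ?subr_gt0// ln_lt0// C0.
move=> k; rewrite !PsiE mulr_sumr big_seq [leRHS]big_seq.
apply: ler_sum => w; rewrite mem_words => /eqP wk.
rewrite (psi_shift s) mulrC ler_wpM2r ?(ltW (psi_gt0 _ _ _ _ _))//.
rewrite -[leRHS]powR_mulrn ?(ltW th0)// -powRrM mulrC powRrM powR_mulrn ?(ltW C0)//.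
rewrite powR_lel ?short_side_gt0 ?subr_ge0 ?(ltW st)// -wk.
exact: le_trans (short_le_long _ _) (hC w).
Qed.

Lemma geometric_sum_le (x : R) n : 0 < x < 1 -> \sum_(k < n) x ^+ k <= (1 - x)^-1.
Proof.
move=> /andP[x0 x1]; have y0 : 0 < 1 - x by rewrite subr_gt0.
rewrite -(ler_pM2l y0) mulfV ?gt_eqF//.
have -> : (1 - x) * \sum_(k < n) x ^+ k = 1 - x ^+ n.
  by rewrite -[1 - x]opprB mulNr -subrX1 opprB.
by rewrite gerBl exprn_ge0// ltW.
Qed.

(** Past the critical exponent the geometric factor of the shift outweighs the
subexponential growth at s, and the series is dominated by a geometric one. *)
Lemma Psi_summable s t : P S s1 s2 s = 1 -> s < t ->
  exists2 B, 0 < B & forall n, \sum_(k < n) Psi t k <= B.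
Proof.
move=> Ps st; have [th /andP[th0 th1] hth] := Psi_shift st.
pose e := (1 - th) / 2.
have [|N hN] := @Psi_root_bounds s e Ps; first by rewrite /e; apply/andP; split; lra.
pose x := th * (1 + e).
have x01 : 0 < x < 1 by rewrite /x /e; apply/andP; split; nra.
have tail k : (N <= k)%N -> Psi t k <= x ^+ k.
  move=> /hN /andP[_ h]; rewrite /x exprMn; apply: le_trans (hth k) _.
  by rewrite ler_wpM2l// exprn_ge0// ltW.
exists (\sum_(k < N) Psi t k + (1 - x)^-1 + 1).
  have y0 : 0 <= (1 - x)^-1 by rewrite invr_ge0 subr_ge0 ltW//; case/andP: x01.
  by rewrite ltr_wpDl// addr_ge0// sumr_ge0// => k _; exact: Psi_ge0.
move=> n; rewrite ler_wpDr//.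
have all k : Psi t k <= (if (k < N)%N then Psi t k else 0) + x ^+ k.
  case: ltnP => h; last by rewrite add0r tail.
  by rewrite lerDl exprn_ge0// ltW//; case/andP: x01.
apply: (@le_trans _ _ (\sum_(k < n) ((if (k < N)%N then Psi t k else 0) + x ^+ k))).
  by apply: ler_sum => k _; exact: all.
rewrite big_split/=; apply: lerD; last exact: geometric_sum_le.
rewrite -(big_mkord xpredT (fun k => if (k < N)%N then Psi t k else 0)).
have [nN|Nn] := leqP n N.
  rewrite -(big_mkord xpredT) [leRHS](big_cat_nat (n := n))//=.
  rewrite -[leLHS]addr0 lerD//; last by apply: sumr_ge0 => k _; exact: Psi_ge0.
  rewrite big_nat [leRHS]big_nat; apply: ler_sum => k /andP[_ kn].
  by case: ifP => // _; exact: Psi_ge0.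
rewrite (big_cat_nat (n := N))//=; last exact: ltnW.
rewrite [X in _ + X]big_nat [X in _ + X]big1 ?addr0; last first.
  by move=> k /andP[Nk _]; rewrite ltnNge Nk.
rewrite -(big_mkord xpredT) big_nat [leRHS]big_nat; apply: ler_sum => k /andP[_ kN].
by rewrite kN.
Qed.

(** Below the critical exponent the shift yields exponential growth, which no
linear bound allows. *)
Lemma Psi_unbounded s t B : P S s1 s2 s = 1 -> t < s ->
  (forall k, Psi t k <= B * k.+1%:R) -> False.
Proof.
move=> Ps ts hB; have [th /andP[th0 th1] hth] := Psi_shift ts.
pose e := (1 - th) / 2.
have [|N hN] := @Psi_root_bounds s e Ps; first by rewrite /e; apply/andP; split; lra.
pose g := (1 - e) / th.
have g1 : 1 < g by rewrite /g ltr_pdivlMr// /e; lra.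
have g0 : 0 < g by apply: lt_trans g1.
have l0 : 0 < ln g by rewrite ln_gt0.
have hg k : (N <= k)%N -> g ^+ k <= B * k.+1%:R.
  move=> /hN /andP[h _]; rewrite /g expr_div_n ler_pdivrMr ?exprn_gt0// mulrC.
  apply: (le_trans h); apply: (le_trans (hth k)).
  by rewrite ler_wpM2l// exprn_ge0// ltW.
have [k [Nk k1 kB]] : exists k : nat,
    [/\ (N <= k)%N, (1 : R) <= k%:R & 4 * `|B| <= k%:R * ln g ^+ 2].
  exists (N + (Num.trunc (4 * `|B| / ln g ^+ 2)).+1)%N.
  split; [exact: leq_addr|by rewrite ler1n addnS|].
  rewrite -ler_pdivrMr ?exprn_gt0//; apply/ltW.
  by apply: lt_le_trans (truncnS_gt _) _; rewrite ler_nat leq_addl.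
have := hg k Nk.
(* g ^ k = exp (k ln g) >= 1 + (k ln g) ^ 2 / 2 beats every linear function of k *)
have := @expR_ge1Dxn R (k%:R * ln g) 1 (mulr_ge0 (ler0n _ _) (ltW l0)).
rewrite expRM_natl lnK// => h1 h2; have := le_trans h1 h2.
have Bk : B * k.+1%:R <= `|B| * (2 * k%:R).
  apply: (@le_trans _ _ (`|B| * k.+1%:R)); first by rewrite ler_wpM2r// ler_norm.
  by rewrite ler_wpM2l// -natr1; lra.
have : 2 * `|B| * k%:R <= (k%:R * ln g) ^+ 2 / 2.
  rewrite exprMn; have := ler_wpM2r (ler0n R k) kB.
  rewrite expr2; lra.
by rewrite (_ : 2`!%:R = 2)//; lra.
Qed.

End pressure.

(** * The upper bound *)

Section upper_bound.
Context {R : realType} {I : finType} (S : box_like_ifs R I).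
Context (F : set 'cV[R]_2) (attractorF : is_attractor S F) (s1 s2 : R).
Hypothesis dim1 : has_box_dim (@real_dist R) (@pi1 R @` F) s1.
Hypothesis dim2 : has_box_dim (@real_dist R) (@pi2 R @` F) s2.

Lemma exp_small (C r : R) : 0 < C < 1 -> 0 < r -> exists K, C ^+ K <= r.
Proof.
move=> /andP[C0 C1] r0.
have C1' : `|C| < 1 by rewrite gtr0_norm.
have [N _ h] : \forall k \near \oo, `|0 - C ^+ k| < r.
  by move/cvgrPdist_lt: (cvg_expr C1'); apply.
exists N; have := h N (leqnn N); rewrite /= sub0r normrN => /ltW; apply: le_trans.
exact: ler_norm.
Qed.

Lemma image_neq0 (T : Type) (f : 'cV[R]_2 -> T) : f @` F !=set0.
Proof. by have [[x Fx] _ _] := attractorF; exists (f x), x. Qed.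

Lemma word_proj_image w : word_proj S w @` F =
  if proj_horizontal S w then @pi1 R @` F else @pi2 R @` F.
Proof. by rewrite /word_proj; case: ifP. Qed.

Lemma word_proj_covered e b : 0 < e -> 0 < b ->
  exists2 C, 0 < C & forall w r, 0 < r <= b ->
    exists2 n, covered (@real_dist R) (word_proj S w @` F) r n &
      n%:R <= C * r `^ (- (word_dim S s1 s2 w + e)).
Proof.
move=> e0 b0.
have [|C1 C10 h1] := covered_unif (image_neq0 _) dim1 (u := s1 + e) _ b0; first by rewrite ltrDl.
have [|C2 C20 h2] := covered_unif (image_neq0 _) dim2 (u := s2 + e) _ b0; first by rewrite ltrDl.
exists (C1 + C2) => [|w r rb]; first exact: addr_gt0.
rewrite word_dimE word_proj_image; case: ifP => _.
  have [n hn nle] := h1 r rb; exists n => //; apply: le_trans nle _.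
  by rewrite ler_wpM2r ?powR_ge0// lerDl ltW.
have [n hn nle] := h2 r rb; exists n => //; apply: le_trans nle _.
by rewrite ler_wpM2r ?powR_ge0// lerDr ltW.
Qed.

Lemma word_proj_covered_ge e b : 0 < e -> 0 < b ->
  exists2 C, 0 < C & forall w r n, 0 < r <= b ->
    covered (@real_dist R) (word_proj S w @` F) r n ->
    C * r `^ (- (word_dim S s1 s2 w - e)) <= n%:R.
Proof.
move=> e0 b0.
have [|C1 C10 h1] := covered_unif_ge (image_neq0 _) dim1 (u := s1 - e) _ b0; first by rewrite gtrBl.
have [|C2 C20 h2] := covered_unif_ge (image_neq0 _) dim2 (u := s2 - e) _ b0; first by rewrite gtrBl.
exists (Num.min C1 C2) => [|w r n rb]; first by rewrite lt_min C10.
rewrite word_dimE word_proj_image; case: ifP => _ hn.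
  by apply: le_trans (h1 r n rb hn); rewrite ler_wpM2r ?powR_ge0// ge_min lexx.
by apply: le_trans (h2 r n rb hn); rewrite ler_wpM2r ?powR_ge0// ge_min lexx orbT.
Qed.

(** The longer side is covered by means of the attached projection, at scale r
divided by its length; across the shorter side the cylinder has size at most a
constant times r, so no further subdivision is needed. *)
Lemma cylinder_covered c t e : 0 < c -> 0 < e ->
  exists M C : R, [/\ 0 < M, 0 < C & forall w r, 0 < r -> c * r <= short_side S w ->
    short_side S w <= r ->
    exists2 n, covered (@eucl_dist R) (word_map S w @` F) (M * r) n &
      n%:R <= C * r `^ (- (t + e)) * psi S s1 s2 t w].
Proof.
move=> c0 e0; have [D D0 hD] := attractor_bounded attractorF.
have [C C0 hC] := word_proj_covered e0 (b := c^-1) ltac:(by rewrite invr_gt0).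
have [K1 K10 hK1] := scale_le t s1 c0; have [K2 K20 hK2] := scale_le t s2 c0.
exists (1 + D), (C * (K1 + K2)); split; [by rewrite addr_gt0|by rewrite mulr_gt0// addr_gt0|].
move=> w r r0 lo hi.
have l0 := long_side_gt0 S w; have sl := short_le_long S w.
have [|n hn nle] := hC w (r / long_side S w).
  rewrite divr_gt0//= ler_pdivrMr// mulrC ler_pdivlMr// mulrC.
  exact: le_trans lo sl.
exists n.
  apply: covered_le (covered_cylinder hD hn).
  rewrite mulrCA divff ?gt_eqF// mulr1 mulrDl mul1r lerD2l mulrC ler_wpM2l// ltW//.
apply: (le_trans nle); rewrite -2!mulrA ler_wpM2l ?(ltW C0)// psiE.
have l1 : long_side S w <= 1.
  have [c' [C' [[_ /andP[C'0 C'1]] _ h _ _]]] := contraction_bounds S.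
  by apply: le_trans (h w) _; rewrite exprn_ile1// ltW.
set X := long_side S w `^ _ * _.
have X0 : 0 <= r `^ (- (t + e)) * X by rewrite !mulr_ge0 ?powR_ge0.
rewrite mulrDl; have := word_dimE S s1 s2 w; rewrite {}/X in X0 *; case: ifP => _ E; rewrite E in X0 *.
  have := hK1 _ _ _ _ r0 lo hi l0 l1 (ltW e0); rewrite -mulrA [X in _ <= _ * X]mulrC.
  by move=> h; rewrite ler_wpDr// mulr_ge0// ltW.
have := hK2 _ _ _ _ r0 lo hi l0 l1 (ltW e0); rewrite -mulrA [X in _ <= _ * X]mulrC.
by move=> h; rewrite ler_wpDl// mulr_ge0// ltW.
Qed.

(** Summing over a stopping set: the sum of the modified singular values over it
is at most their sum over all words, which is finite above the critical
exponent. *)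
Lemma attractor_covered s t e : P S s1 s2 s = 1 -> s < t -> 0 < e ->
  exists M C : R, [/\ 0 < M, 0 < C & forall r, 0 < r < 1 ->
    exists2 n, covered (@eucl_dist R) F (M * r) n & n%:R <= C * r `^ (- (t + e))].
Proof.
move=> Ps st e0.
have [c [C' [[/andP[c0 _] C'01] _ hC' _ hc]]] := contraction_bounds S.
have [M [C [M0 C0 hMC]]] := cylinder_covered t c0 e0.
have [B B0 hB] := Psi_summable Ps st.
exists M, (C * B); split=> [//||r /andP[r0 r1]]; first exact: mulr_gt0.
have [K CK] := exp_small C'01 r0.
set Q := stopping_set (short_side S) r K.
have hQ w : exists n, w \in Q -> covered (@eucl_dist R) (word_map S w @` F) (M * r) n /\
    n%:R <= C * r `^ (- (t + e)) * psi S s1 s2 t w.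
  have [|_] := boolP (w \in Q); last by exists 0.
  rewrite mem_stopping_set => /andP[/(stopped_short_side hc c0)/andP[lo hi] _].
  by have [n hn nle] := hMC w r r0 lo hi; exists n.
have [n hn] := choice hQ.
exists (\sum_(w <- Q) n w)%N.
  apply: covered_sub (attractor_stopping_set attractorF hC' CK r1) _.
  by apply: covered_bigcup => w /hn[].
rewrite natr_sum; apply: (@le_trans _ _ (\sum_(w <- Q) C * r `^ (- (t + e)) * psi S s1 s2 t w)).
  by rewrite big_seq [leRHS]big_seq; apply: ler_sum => w /hn[].
rewrite -mulr_sumr [leRHS]mulrAC ler_wpM2l ?mulr_ge0 ?powR_ge0 ?(ltW C0)//.
apply: le_trans (hB K.+1); under [leRHS]eq_bigr => k _ do rewrite PsiE.
by apply: sum_stopping_set_le => w; apply/ltW/psi_gt0.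
Qed.

Lemma upper_box_dim_attractor s : P S s1 s2 s = 1 ->
  (upper_box_dim (@eucl_dist R) F <= s%:E)%E.
Proof.
move=> Ps; apply/lee_addgt0Pr => x x0.
have x20 : 0 < x / 2 by rewrite divr_gt0.
have [|M [C [M0 C0 h]]] := attractor_covered Ps (t := s + x / 2) _ x20.
  by rewrite ltrDl.
rewrite -EFinD (_ : s + x = s + x / 2 + x / 2); last by rewrite -addrA -splitr.
exact: (upper_box_dim_le C0 M0 ltr01 h).
Qed.

End upper_bound.

(** * Disjoint rectangles and the lower bound *)

Section counting.
Context {R : realType}.

Lemma covered_meeting {T : Type} (d : T -> T -> R) (A : set T) r n (U : 'I_n -> set T) :
  A `<=` \bigcup_i U i -> (forall i x y, U i x -> U i y -> d x y <= r) ->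
  covered d A r #|[pred i | `[< U i `&` A !=set0 >]]|.
Proof.
set J := [pred i | _] => cU dU.
exists (fun j => U (enum_val j)); split=> [x Ax|j x y]; last exact: dU.
have [i _ Ui] := cU x Ax.
have iJ : i \in J by apply/asboolP; exists x.
by exists (enum_rank_in iJ i) => //; rewrite enum_rankK_in.
Qed.

Lemma size_int_box (W : eqType) (Q : seq W) (f : W -> int * int) (k1 k2 : int) (N : nat) :
  uniq Q -> {in Q &, injective f} ->
  (forall w, w \in Q -> `|(f w).1 - k1| <= N%:Z /\ `|(f w).2 - k2| <= N%:Z) ->
  (size Q <= (2 * N).+1 * (2 * N).+1)%N.
Proof.
move=> uQ injf hf.
pose shift (k z : int) : 'I_(2 * N).+1 := inord (absz (z - k + N%:Z)).
have shiftE k z : `|z - k| <= N%:Z -> (shift k z : nat) = absz (z - k + N%:Z).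
  move=> h; rewrite /shift inordK//; lia.
pose g w := (shift k1 (f w).1, shift k2 (f w).2).
have injg : {in Q &, injective g}.
  move=> u v uQ' vQ' [/(congr1 val)/= e1 /(congr1 val)/= e2]; apply: injf => //.
  have [u1 u2] := hf u uQ'; have [v1 v2] := hf v vQ'.
  move: e1 e2; rewrite !shiftE// => e1 e2.
  by case: (f u) (f v) u1 u2 v1 v2 e1 e2 => [a b] [a' b'] /= u1 u2 v1 v2 e1 e2; congr pair; lia.
have <- : #|{: 'I_(2 * N).+1 * 'I_(2 * N).+1}| = ((2 * N).+1 * (2 * N).+1)%N.
  by rewrite card_prod card_ord.
rewrite -(size_map g).
have /card_uniqP <- : uniq (map g Q) by rewrite map_inj_in_uniq.
exact: max_card.
Qed.

(** The image of [a, b] contains an interval of length 2 * eta around the image of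
q, and such an interval has a multiple of eta in its interior. *)
Lemma grid_point (a b al be q eta : R) : a < b -> al != 0 -> a <= q <= b -> 0 < eta ->
  2 * eta <= `|al| * (b - a) ->
  exists z (k : int), [/\ a < z < b, al * z + be = k%:~R * eta &
     `|k%:~R * eta - (al * q + be)| <= 2 * eta].
Proof.
move=> ab al0 /andP[aq qb] eta0 h.
set p := al * q + be.
set lo := Num.min (al * a + be) (al * b + be); set hi := Num.max (al * a + be) (al * b + be).
have [lohi hz] : hi - lo = `|al| * (b - a) /\
    forall z, lo < al * z + be < hi -> a < z < b.
  rewrite /lo /hi; have [al_gt|al_le] := ltP 0 al.
    have e : al * a + be <= al * b + be by rewrite lerD2r ler_pM2l// ltW.
    rewrite (min_idPl e) (max_idPr e) gtr0_norm//; split; first ring.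
    by move=> z; rewrite !ltrD2r !ltr_pM2l.
  have al_lt : al < 0 by rewrite lt_neqAle al0.
  have e : al * b + be <= al * a + be by rewrite lerD2r ler_nM2l// ltW.
  rewrite (min_idPr e) (max_idPl e) ltr0_norm//; split; first ring.
  by move=> z; rewrite !ltrD2r !ltr_nM2l// andbC.
have [plo phi] : lo <= p /\ p <= hi.
  rewrite /lo /hi /p; have [al_ge|/ltW al_le] := leP 0 al.
    by split; [rewrite ge_min lerD2r ler_wpM2l|rewrite le_max !lerD2r (ler_wpM2l al_ge qb) orbT].
  by split; [rewrite ge_min !lerD2r (ler_wnM2l al_le qb) orbT|rewrite le_max lerD2r ler_wnM2l].
rewrite -lohi in h.
pose l := Num.min p (hi - 2 * eta).
have [l1 [l2 [l3 l4]]] : l <= p /\ p <= l + 2 * eta /\ lo <= l /\ l + 2 * eta <= hi.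
  by rewrite /l; have [?|?] := leP p (hi - 2 * eta); do !split; lra.
pose k := Num.floor (l / eta) + 1.
have k1 : l < k%:~R * eta by rewrite -ltr_pdivrMr// /k floorD1_gt.
have k2 : k%:~R * eta <= l + eta.
  rewrite /k intrD mulrDl mul1r lerD2r -ler_pdivlMr//; exact: floor_le.
exists ((k%:~R * eta - be) / al), k.
have E : al * ((k%:~R * eta - be) / al) + be = k%:~R * eta.
  by rewrite mulrCA divff// mulr1 subrK.
split=> //; first by apply: hz; rewrite E; apply/andP; split; lra.
by rewrite ler_norml; apply/andP; split; lra.
Qed.

End counting.

Section open_rectangle.
Context {R : realType} {I : finType} (S : box_like_ifs R I).
Context (F : set 'cV[R]_2) (attractorF : is_attractor S F).
Context (x0 x1 y0 y1 : R) (ltx : x0 < x1) (lty : y0 < y1).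

Local Notation rect := (open_rect x0 x1 y0 y1).

Hypothesis rect_sub : forall i, smap S i @` rect `<=` rect.
Hypothesis rect_disj : trivIset setT (fun i => smap S i @` rect).

Lemma word_map_rect w z : rect z -> rect (word_map S w z).
Proof.
move=> hz; elim: w => //= i w IH; apply: (rect_sub (i := i)).
by exists (word_map S w z).
Qed.

Lemma word_map_inj w : injective (word_map S w).
Proof.
move=> x y E; have := word_map_dist0 S w x y; have := word_map_dist1 S w x y.
rewrite E !subrr normr0 => /esym/eqP h1 /esym/eqP h0; move: h1 h0.
have b0 := base_len_gt0 S w; have h0 := height_len_gt0 S w.
by case: (is_typeB S w); rewrite !mulf_eq0 (gt_eqF b0) (gt_eqF h0) !normr_eq0 !subr_eq0 =>
  /eqP e1 /eqP e0; apply: col2P.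
Qed.

(** At the first letter where two incomparable words differ, the rectangles are
images of disjoint ones under one injective map. *)
Lemma incomparable_disjoint u v z z' : ~~ prefix u v -> ~~ prefix v u ->
  rect z -> rect z' -> word_map S u z <> word_map S v z'.
Proof.
elim: u v => [|i u IH] [|j v]//=; rewrite /= !(eq_sym j) => uv vu hz hz' E.
have ij : i = j.
  apply: (rect_disj (i := i) (j := j)) => //; exists (smap S i (word_map S u z)); split.
    by exists (word_map S u z) => //; exact: word_map_rect.
  by exists (word_map S v z') => //; exact: word_map_rect.
rewrite -ij eqxx /= in uv vu E *.
apply: (IH v uv vu hz hz'); apply: (@word_map_inj [:: i]); exact: E.
Qed.

(** F may meet the boundary of the open rectangle but not its exterior: the
images under long words of a point of the rectangle come arbitrarily close to
any point of F. *)
Lemma attractor_in_closed_rect y : F y -> x0 <= y 0 0 <= x1 /\ y0 <= y 1 0 <= y1.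
Proof.
move=> Fy; have [D D0 hD] := attractor_bounded attractorF.
have [c [C [[_ C01] _ hC _ _]]] := contraction_bounds S.
pose q := vec2 ((x0 + x1) / 2) ((y0 + y1) / 2).
have hq : rect q.
  have [hx1 hx2] := midf_lt ltx; have [hy1 hy2] := midf_lt lty.
  by rewrite /open_rect /pi1 /pi2 /= vec2_0 vec2_1 hx1 hx2 hy1 hy2.
pose B := D + D + `|y 0 0 - q 0 0| + `|y 1 0 - q 1 0| + 1.
have B0 : 0 < B by rewrite ltr_wpDl// !addr_ge0// ltW.
have near e : 0 < e -> exists2 z, rect z & forall i, `|y i 0 - z i 0| <= e.
  move=> e0; have [|K hK] := exp_small C01 (r := e / B); first by rewrite divr_gt0.
  have [w wK [y' Fy' <-]] := attractor_words attractorF K Fy.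
  exists (word_map S w q) => [|i]; first exact: word_map_rect.
  have dB j : `|y' j 0 - q j 0| <= B.
    rewrite (_ : y' j 0 - q j 0 = (y' j 0 - y j 0) + (y j 0 - q j 0)); last ring.
    apply: (le_trans (ler_normD _ _)); have := hD _ _ j Fy' Fy.
    have := normr_ge0 (y 0 0 - q 0 0); have := normr_ge0 (y 1 0 - q 1 0).
    rewrite /B; elim/ord2P: j; lra.
  have sc (L : R) j : L <= long_side S w -> 0 < L -> L * `|y' j 0 - q j 0| <= e.
    move=> Ll L0; have Le : L <= e / B.
      by apply: (le_trans Ll); apply: le_trans (hC w) _; rewrite wK.
    apply: (@le_trans _ _ (e / B * B)); last by rewrite mulfVK ?gt_eqF.
    by apply: ler_pM => //; exact: ltW.
  have bl : base_len S w <= long_side S w by rewrite le_max lexx.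
  have hl : height_len S w <= long_side S w by rewrite le_max lexx orbT.
  elim/ord2P: i.
    by rewrite word_map_dist0; case: (is_typeB S w); apply: sc; rewrite ?base_len_gt0.
  by rewrite word_map_dist1; case: (is_typeB S w); apply: sc; rewrite ?height_len_gt0.
split; apply/andP; split; rewrite leNgt; apply/negP => h.
- have [|z [/andP[z1 z2] _]] := near ((x0 - y 0 0) / 2); first by rewrite divr_gt0// subr_gt0.
  by move=> /(_ 0); rewrite ler_distl => /andP[]; rewrite /pi1 in z1 z2; lra.
- have [|z [/andP[z1 z2] _]] := near ((y 0 0 - x1) / 2); first by rewrite divr_gt0// subr_gt0.
  by move=> /(_ 0); rewrite ler_distl => /andP[]; rewrite /pi1 in z1 z2; lra.
- have [|z [_ /andP[z1 z2]]] := near ((y0 - y 1 0) / 2); first by rewrite divr_gt0// subr_gt0.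
  by move=> /(_ 1); rewrite ler_distl => /andP[]; rewrite /pi2 in z1 z2; lra.
- have [|z [_ /andP[z1 z2]]] := near ((y 1 0 - y1) / 2); first by rewrite divr_gt0// subr_gt0.
  by move=> /(_ 1); rewrite ler_distl => /andP[]; rewrite /pi2 in z1 z2; lra.
Qed.

Lemma word_map_grid w y eta : F y -> 0 < eta ->
  2 * eta <= short_side S w * Num.min (x1 - x0) (y1 - y0) ->
  exists z (k1 k2 : int), [/\ rect z,
    word_map S w z 0 0 = k1%:~R * eta, word_map S w z 1 0 = k2%:~R * eta,
    `|k1%:~R * eta - word_map S w y 0 0| <= 2 * eta &
    `|k2%:~R * eta - word_map S w y 1 0| <= 2 * eta].
Proof.
move=> Fy eta0 h; have [hy0 hy1] := attractor_in_closed_rect Fy.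
have m0 : 0 < Num.min (x1 - x0) (y1 - y0) by rewrite lt_min !subr_gt0 ltx.
have le L l : short_side S w <= L -> Num.min (x1 - x0) (y1 - y0) <= l -> 2 * eta <= L * l.
  by move=> hL hl; apply: (le_trans h); apply: ler_pM => //; rewrite ltW ?short_side_gt0.
have bl : short_side S w <= base_len S w by rewrite ge_min lexx.
have hl : short_side S w <= height_len S w by rewrite ge_min lexx orbT.
have mx : Num.min (x1 - x0) (y1 - y0) <= x1 - x0 by rewrite ge_min lexx.
have my : Num.min (x1 - x0) (y1 - y0) <= y1 - y0 by rewrite ge_min lexx orbT.
have fE z i : word_map S w z i 0 =
    word_lin S w i 0 * z 0 0 + word_lin S w i 1 * z 1 0 + word_map S w 0 i 0.
  by rewrite word_mapE mxE mulmx2E.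
move: bl hl; rewrite /base_len /height_len.
case: (monomialP (word_lin_monomial S w)) => p q e1 e2 bl hl.
  have [zx [k1 [hx kx dx]]] := grid_point (word_map S w 0 0 0) ltx p hy0 eta0 (le _ _ bl mx).
  have [zy [k2 [hy ky dy]]] := grid_point (word_map S w 0 1 0) lty q hy1 eta0 (le _ _ hl my).
  exists (vec2 zx zy), k1, k2.
  rewrite (fE y) (fE y) !(fE (vec2 _ _)) e1 e2 !vec2_0 !vec2_1 !mul0r !addr0 !add0r; split=> //.
  by rewrite /open_rect /pi1 /pi2/= vec2_0 vec2_1.
have [zy [k1 [hy kx dx]]] := grid_point (word_map S w 0 0 0) lty p hy1 eta0 (le _ _ bl my).
have [zx [k2 [hx ky dy]]] := grid_point (word_map S w 0 1 0) ltx q hy0 eta0 (le _ _ hl mx).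
exists (vec2 zx zy), k1, k2.
rewrite (fE y) (fE y) !(fE (vec2 _ _)) e1 e2 !vec2_0 !vec2_1 !mul0r !addr0 !add0r; split=> //.
by rewrite /open_rect /pi1 /pi2/= vec2_0 vec2_1.
Qed.

(** The open rectangles of an antichain are disjoint, and each of those whose
cylinder meets U contains a point of a grid of mesh comparable to r that is close
to U; there are boundedly many such grid points. *)
Lemma antichain_meeting_bound c : 0 < c -> exists M : nat,
  forall r (Q : seq (seq I)) (U : set 'cV[R]_2), 0 < r -> uniq Q ->
  {in Q &, forall u v, prefix u v -> u = v} ->
  (forall w, w \in Q -> c * r <= short_side S w) ->
  (forall x y, U x -> U y -> eucl_dist x y <= r) ->
  (size [seq w <- Q | `[< U `&` (word_map S w @` F) !=set0 >]] <= M)%N.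
Proof.
move=> c0; set m := Num.min (x1 - x0) (y1 - y0).
have m0 : 0 < m by rewrite lt_min !subr_gt0 ltx.
(* in units of the mesh eta = c * m * r / 2, the set has diameter 2 / (c * m), the
grid point is at distance at most 2 from it, and rounding costs 1 *)
pose N := (Num.trunc (2 / (c * m) + 3)).+1.
have hN : 2 / (c * m) + 3 <= N%:R by apply/ltW/truncnS_gt.
exists ((2 * N).+1 * (2 * N).+1)%N => r Q U r0 uQ anti lo dU.
set Q' := [seq w <- Q | _].
pose eta := c * m * r / 2.
have eta0 : 0 < eta by rewrite /eta divr_gt0// !mulr_gt0.
have [->|] := eqVneq Q' [::]; first by [].
case E: Q' => [//|w0 Q0] _; rewrite -E.
have : w0 \in Q' by rewrite E mem_head.
rewrite mem_filter => /andP[/asboolP[p0 [Up0 _]] _].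
have hgrid w : exists k : int * int, w \in Q' -> exists z, [/\ rect z,
    word_map S w z 0 0 = k.1%:~R * eta, word_map S w z 1 0 = k.2%:~R * eta,
    `|k.1%:~R * eta - p0 0 0| <= r + 2 * eta & `|k.2%:~R * eta - p0 1 0| <= r + 2 * eta].
  have [|_] := boolP (w \in Q'); last by exists (0, 0).
  rewrite mem_filter => /andP[/asboolP[x [Ux [y Fy yx]]] wQ]; rewrite -yx in Ux.
  have [|z [k1 [k2 [hz e1 e2 d1 d2]]]] := @word_map_grid w y eta Fy eta0.
    by rewrite /eta mulrC divfK ?pnatr_eq0// -mulrA (mulrC m) mulrA ler_pM2r// lo.
  have dU' j : `|word_map S w y j 0 - p0 j 0| <= r.
    exact: le_trans (eucl_dist_coord _ _ _) (dU _ _ Ux Up0).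
  have tri (k : int) j : `|k%:~R * eta - word_map S w y j 0| <= 2 * eta ->
      `|k%:~R * eta - p0 j 0| <= r + 2 * eta.
    move=> hk; rewrite [leRHS]addrC; apply: le_trans (lerD hk (dU' j)).
    by apply: le_trans (ler_normD _ _); rewrite addrA subrK.
  by exists (k1, k2) => _; exists z; split=> //; apply: tri.
have [f hf] := choice hgrid.
apply: (@size_int_box _ Q' f (Num.floor (p0 0 0 / eta)) (Num.floor (p0 1 0 / eta))).
- by rewrite filter_uniq.
- move=> u v uQ' vQ' fuv; have [z [hz e1 e2 _ _]] := hf u uQ'.
  have [z' [hz' e1' e2' _ _]] := hf v vQ'.
  move: (uQ') (vQ'); rewrite !mem_filter => /andP[_ uQ''] /andP[_ vQ''].
  apply: contrapT => uv; apply: (@incomparable_disjoint u v z z') => //.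
  + by apply/negP => /(anti _ _ uQ'' vQ'').
  + by apply/negP => /(anti _ _ vQ'' uQ'')/esym.
  + by apply: col2P; rewrite ?e1 ?e2 ?e1' ?e2' fuv.
have bound (k : int) (p : R) : `|k%:~R * eta - p| <= r + 2 * eta ->
    `|k - Num.floor (p / eta)| <= N%:Z.
  move=> h; rewrite -(ler_int R) intr_norm intrB; apply: le_trans hN.
  have -> : k%:~R - (Num.floor (p / eta))%:~R =
      (k%:~R * eta - p) / eta + (p / eta - (Num.floor (p / eta))%:~R) :> R.
    by rewrite mulrBl mulfK ?gt_eqF// addrA subrK.
  apply: (le_trans (ler_normD _ _)).
  have h1 : `|(k%:~R * eta - p) / eta| <= 2 / (c * m) + 2.
    rewrite normrM normfV (gtr0_norm eta0) ler_pdivrMr// (le_trans h)//.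
    rewrite [leRHS]mulrDl lerD2r /eta le_eqVlt; apply/orP; left; apply/eqP; field.
    by rewrite !gt_eqF.
  have h2 : `|p / eta - (Num.floor (p / eta))%:~R| <= 1.
    have f1 := floor_le (p / eta); have f2 := floorD1_gt (p / eta).
    rewrite intrD in f2; rewrite ger0_norm ?subr_ge0//; lra.
  lra.
by move=> w /hf [z [_ _ _ h1 h2]]; split; exact: bound.
Qed.

End open_rectangle.

Section lower_bound.
Context {R : realType} {I : finType} (S : box_like_ifs R I).
Context (F : set 'cV[R]_2) (attractorF : is_attractor S F) (s1 s2 : R).
Hypothesis dim1 : has_box_dim (@real_dist R) (@pi1 R @` F) s1.
Hypothesis dim2 : has_box_dim (@real_dist R) (@pi2 R @` F) s2.

Local Notation psi := (psi S s1 s2).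

(** A cover of a cylinder projects to a cover of a scaled copy of a projection
of F. *)
Lemma cylinder_covered_ge c t e : 0 < c -> 0 < e ->
  exists2 C, 0 < C & forall w r n, 0 < r -> c * r <= short_side S w ->
    short_side S w <= r ->
    covered (@eucl_dist R) (word_map S w @` F) r n ->
    C * r `^ (- (t - e)) * psi t w <= n%:R.
Proof.
move=> c0 e0.
have [C C0 hC] := word_proj_covered_ge attractorF dim1 dim2 e0 (b := c^-1) ltac:(by rewrite invr_gt0).
have [K1 K10 hK1] := scale_ge t s1 c0; have [K2 K20 hK2] := scale_ge t s2 c0.
exists (C * Num.min K1 K2); first by rewrite mulr_gt0// lt_min K10.
move=> w r n r0 lo hi hn.
have l0 := long_side_gt0 S w; have sl := short_le_long S w.
have hr : 0 < r / long_side S w <= c^-1.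
  rewrite divr_gt0//= ler_pdivrMr// mulrC ler_pdivlMr// mulrC.
  exact: le_trans lo sl.
have h := hC w _ n hr; apply: le_trans (h _); last first.
  apply: (@covered_cylinder_proj _ _ S F w (r / long_side S w)).
  by rewrite mulrCA divff ?gt_eqF// mulr1.
rewrite -2!mulrA ler_wpM2l ?(ltW C0)// psiE.
have l1 : long_side S w <= 1.
  have [c' [C' [[_ /andP[C'0 C'1]] _ k _ _]]] := contraction_bounds S.
  by apply: le_trans (k w) _; rewrite exprn_ile1// ltW.
have X0 p : 0 <= r `^ (- (t - e)) * (long_side S w `^ p * short_side S w `^ (t - p)).
  by rewrite !mulr_ge0 ?powR_ge0.
rewrite word_dimE; case: ifP => _.
  apply: le_trans (hK1 _ _ _ _ r0 lo hi l0 l1 (ltW e0)).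
  rewrite -mulrA [X in _ <= _ * X]mulrC ler_wpM2r//.
  by rewrite ge_min lexx.
apply: le_trans (hK2 _ _ _ _ r0 lo hi l0 l1 (ltW e0)).
rewrite -mulrA [X in _ <= _ * X]mulrC ler_wpM2r//.
by rewrite ge_min lexx orbT.
Qed.

(** Double counting of the pairs formed by a cylinder and a set of the cover that
meets it. *)
Lemma antichain_sum_le c t e : ROSC S -> 0 < c -> 0 < e ->
  exists2 C, 0 < C & forall r (Q : seq (seq I)) n, 0 < r -> uniq Q ->
    {in Q &, forall u v, prefix u v -> u = v} ->
    (forall w, w \in Q -> c * r <= short_side S w <= r) ->
    covered (@eucl_dist R) F r n ->
    C * r `^ (- (t - e)) * \sum_(w <- Q) psi t w <= n%:R.
Proof.
move=> [x0 [x1 [y0 [y1 [ltx lty sub disj]]]]] c0 e0.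
have [M hM] := antichain_meeting_bound attractorF ltx lty sub disj c0.
have [C C0 hC] := cylinder_covered_ge t c0 e0.
exists (C / M.+1%:R) => [|r Q n r0 uQ anti hQ [U [cU dU]]]; first by rewrite divr_gt0.
have lo w : w \in Q -> c * r <= short_side S w by move=> /hQ/andP[].
rewrite -!mulrA mulrCA -(ler_pM2l (ltr0Sn R M)) mulVKf ?pnatr_eq0//.
rewrite mulrA mulr_sumr.
pose J w := [pred i : 'I_n | `[< U i `&` (word_map S w @` F) !=set0 >]].
apply: (@le_trans _ _ (\sum_(w <- Q) #|J w|%:R)).
  rewrite big_seq [leRHS]big_seq; apply: ler_sum => w wQ.
  have /andP[lo_w hi_w] := hQ w wQ.
  apply: hC r0 lo_w hi_w _; apply: covered_meeting; last exact: dU.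
  by apply: subset_trans cU => _ [x Fx <-]; exact: word_map_attractor.
rewrite -natr_sum -natrM ler_nat.
under eq_bigr => w _ do rewrite -sum1_card big_mkcond/=.
rewrite exchange_big/= mulnC -[n in (n * _)%N]card_ord -sum_nat_const.
apply: leq_sum => i _; rewrite -big_mkcond/= sum1_count.
rewrite -size_filter (leq_trans (hM r Q (U i) r0 uQ anti lo (dU i)))//.
Qed.

Lemma covered_product r m n : covered (@real_dist R) (@pi1 R @` F) r m ->
  covered (@real_dist R) (@pi2 R @` F) r n ->
  covered (@eucl_dist R) F (r + r) (m * n).
Proof.
move=> [U [cU dU]] [V [cV dV]].
have -> : (m * n = #|{: 'I_m * 'I_n}|)%N by rewrite card_prod !card_ord.
pose W (ij : 'I_m * 'I_n) := [set x | U ij.1 (pi1 x) /\ V ij.2 (pi2 x)].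
exists (W \o enum_val); split=> [x Fx|k x y [Ux Vx] [Uy Vy]].
  have [|i _ Ui] := cU (pi1 x); first by exists x.
  have [|j _ Vj] := cV (pi2 x); first by exists x.
  by exists (enum_rank (i, j)) => //=; rewrite enum_rankK.
apply: le_trans (eucl_dist_le _ _) _; apply: lerD; first exact: dU Ux Uy.
exact: dV Vx Vy.
Qed.

(** F lies in the product of its projections, which bounds its covering numbers
from above; the double counting then bounds the sums over antichains. *)
Lemma antichain_sum_bounded c t : ROSC S -> 0 < c -> s1 + s2 < t ->
  exists B, forall r (Q : seq (seq I)), 0 < r <= 1 -> uniq Q ->
    {in Q &, forall u v, prefix u v -> u = v} ->
    (forall w, w \in Q -> c * r <= short_side S w <= r) ->
    \sum_(w <- Q) psi t w <= B.
Proof.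
(* one e is lost for each projection and one in the double counting *)
move=> rosc c0 st; pose e := (t - (s1 + s2)) / 3.
have e0 : 0 < e by rewrite divr_gt0// subr_gt0.
have [C C0 hC] := antichain_sum_le t rosc c0 e0.
have [|C1 C10 h1] := covered_unif (image_neq0 attractorF _) dim1 (u := s1 + e) _ ltr01.
  by rewrite ltrDl.
have [|C2 C20 h2] := covered_unif (image_neq0 attractorF _) dim2 (u := s2 + e) _ ltr01.
  by rewrite ltrDl.
pose u := s1 + s2 + 2 * e.
exists (C^-1 * (C1 * C2 * 2^-1 `^ (- u))) => r Q /andP[r0 r1] uQ anti hQ.
have r2 : 0 < r / 2 <= 1 by apply/andP; split; lra.
have [n1 hn1 le1] := h1 _ r2; have [n2 hn2 le2] := h2 _ r2.
have := covered_product hn1 hn2; rewrite -splitr => /(hC r Q _ r0 uQ anti hQ).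
rewrite -mulrA -ler_pdivlMl// => h.
rewrite -(ler_pM2l (powR_gt0 (- (t - e)) r0)); apply: (le_trans h).
rewrite mulrCA ler_pM2l ?invr_gt0// natrM.
apply: (le_trans (ler_pM (ler0n _ _) (ler0n _ _) le1 le2)).
rewrite mulrACA -powRDp ?divr_gt0//.
have -> : - (s1 + e) + - (s2 + e) = - u by rewrite /u; ring.
rewrite powRM ?invr_ge0 ?(ltW r0)// mulrCA.
by rewrite (_ : t - e = u)// /u /e; field.
Qed.

(** The words of length k, split into k.+1 classes according to the size of the
short side, give antichains; so at an exponent t > s1 + s2 the sums over words of
length k grow at most linearly, which is impossible for t < s. *)
Lemma exponent_le_dim_sum s : ROSC S -> P S s1 s2 s = 1 -> s <= s1 + s2.
Proof.
move=> rosc Ps; rewrite leNgt; apply/negP => lts.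
have [lt1 lt2] := midf_lt lts; set t := (s1 + s2 + s) / 2 in lt1 lt2.
have [c [C [[/andP[c0 c1] C01] hc hC _ _]]] := contraction_bounds S.
have [B hB] := antichain_sum_bounded rosc c0 lt1.
apply: (@Psi_unbounded _ _ S s1 s2 s t B Ps lt2) => k; rewrite PsiE.
pose Q (j : nat) := [seq w <- words k | c ^+ j.+1 <= short_side S w <= c ^+ j].
have hQ j : \sum_(w <- Q j) psi t w <= B.
  apply: (hB (c ^+ j)).
  - by rewrite exprn_gt0//= exprn_ile1// ltW.
  - exact: filter_uniq (words_uniq k).
  - move=> u v; rewrite !mem_filter !mem_words => /andP[_ /eqP su] /andP[_ /eqP sv].
    move=> /prefixP[z vE]; move: sv; rewrite vE size_cat su => /eqP.
    by rewrite -[X in _ == X]addn0 eqn_add2l size_eq0 => /eqP ->; rewrite cats0.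
  - by move=> w; rewrite mem_filter -exprS => /andP[].
apply: (@le_trans _ _ (\sum_(j < k.+1) \sum_(w <- Q j) psi t w)); last first.
  apply: (@le_trans _ _ (\sum_(j < k.+1) B)); first by apply: ler_sum => j _.
  by rewrite sumr_const card_ord mulr_natr.
under [leRHS]eq_bigr => j _ do rewrite big_filter big_mkcond.
rewrite exchange_big/= big_seq [leRHS]big_seq; apply: ler_sum => w.
rewrite mem_words => /eqP wk.
have ex : exists j, c ^+ j.+1 <= short_side S w.
  by exists k; apply: le_trans (hc w); rewrite wk exprS ler_piMl// exprn_ge0// ltW.
case: (ex_minnP ex) => j hj jmin.
have jk : (j < k.+1)%N.
  rewrite ltnS; apply: jmin; apply: le_trans (hc w).
  by rewrite wk exprS ler_piMl// exprn_ge0// ltW.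
have hj2 : short_side S w <= c ^+ j.
  case: j jmin {hj jk} => [_|j jmin].
    rewrite expr0; apply: le_trans (short_le_long _ _) _; apply: le_trans (hC w) _.
    by case/andP: C01 => C0 C1; rewrite exprn_ile1// ltW.
  by rewrite leNgt; apply/negP => /ltW /jmin; rewrite ltnn.
rewrite (bigD1 (Ordinal jk))//= hj hj2/= lerDl sumr_ge0// => i _.
by case: ifP => // _; apply/ltW/psi_gt0.
Qed.

Lemma box_dim_le_of_expansion (f g : 'cV[R]_2 -> R) (phi : 'cV[R]_2 -> 'cV[R]_2)
    (u v la : R) :
  has_box_dim (@real_dist R) (f @` F) u -> has_box_dim (@real_dist R) (g @` F) v ->
  0 < la -> (forall x, F x -> F (phi x)) ->
  (forall x y, la * `|g x - g y| <= `|f (phi x) - f (phi y)|) -> v <= u.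
Proof.
move=> hf hg la0 Fphi hphi; apply/ler_addgt0Pr => e e0.
have [|C C0 hC] := covered_unif (image_neq0 attractorF _) hf (u := u + e) _ ltr01.
  by rewrite ltrDl.
rewrite -lee_fin; case: (hg) => _ <-.
apply: (@upper_box_dim_le _ _ _ _ _ C la^-1 1) => //; first by rewrite invr_gt0.
move=> r /andP[r0 r1]; have [|n [U [cU dU]] nle] := hC r; first by rewrite r0 ltW.
exists n => //; exists (fun i => [set z | exists2 x, F x & z = g x /\ U i (f (phi x))]).
split=> [_ [x Fx <-]|i _ _ [x Fx [-> Ux]] [y Fy [-> Uy]]].
  have [|i _ Ui] := cU (f (phi x)); first by exists (phi x) => //; exact: Fphi.
  by exists i => //; exists x.
rewrite mulrC ler_pdivlMr// mulrC; apply: le_trans (hphi x y) _.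
exact: dU Ux Uy.
Qed.

(** A map of type B embeds a scaled copy of each projection of F into the other
one. *)
Lemma typeB_dims_eq i : is_typeB S [:: i] -> s1 = s2.
Proof.
move=> tB; have Fi x : F x -> F (word_map S [:: i] x) by exact: word_map_attractor.
have d0 := word_map_dist0 S [:: i]; have d1 := word_map_dist1 S [:: i].
rewrite tB in d0 d1.
apply/eqP; rewrite eq_le; apply/andP; split.
  apply: (box_dim_le_of_expansion dim2 dim1 (height_len_gt0 S [:: i]) Fi) => x y.
  by rewrite /pi1 /pi2 d1.
apply: (box_dim_le_of_expansion dim1 dim2 (base_len_gt0 S [:: i]) Fi) => x y.
by rewrite /pi1 /pi2 d0.
Qed.

Lemma typeB_or_dims_eq : (forall w, is_typeB S w = false) \/ s1 = s2.
Proof.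
have [/existsP[i tB]|] := boolP [exists i, is_typeB S [:: i]].
  by right; exact: typeB_dims_eq tB.
rewrite negb_exists => /forallP nB; left; elim=> [|i w IH]; first exact: is_typeB_nil.
by rewrite -cat1s is_typeB_cat IH (negPf (nB i)).
Qed.

(** For exponents at most s1 + s2 the modified singular value of a rectangle of
width b and height h is the larger of two expressions, each multiplicative in
(b, h); this is what makes it submultiplicative. *)
Definition weight1 t (b h : R) := b `^ s1 * h `^ (t - s1).
Definition weight2 t (b h : R) := h `^ s2 * b `^ (t - s2).

Lemma weight_le t b h : t <= s1 + s2 -> 0 < h -> h <= b -> weight2 t b h <= weight1 t b h.
Proof.
move=> ts h0 hb; have b0 := lt_le_trans h0 hb; rewrite /weight1 /weight2.
have -> : b `^ s1 = b `^ (s1 + s2 - t) * b `^ (t - s2).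
  by rewrite -powRDp//; congr (_ `^ _); ring.
have -> : h `^ s2 = h `^ (s1 + s2 - t) * h `^ (t - s1).
  by rewrite -powRDp//; congr (_ `^ _); ring.
have h1 : h `^ (s1 + s2 - t) <= b `^ (s1 + s2 - t) by rewrite powR_lel// subr_ge0.
have p1 := powR_ge0 h (t - s1); have p2 := powR_ge0 b (t - s2).
have := ler_wpM2r (mulr_ge0 p1 p2) h1; lra.
Qed.

Lemma weight_ge t b h : t <= s1 + s2 -> 0 < b -> b <= h -> weight1 t b h <= weight2 t b h.
Proof.
move=> ts b0 bh; have h0 := lt_le_trans b0 bh; rewrite /weight1 /weight2.
have -> : b `^ s1 = b `^ (s1 + s2 - t) * b `^ (t - s2).
  by rewrite -powRDp//; congr (_ `^ _); ring.
have -> : h `^ s2 = h `^ (s1 + s2 - t) * h `^ (t - s1).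
  by rewrite -powRDp//; congr (_ `^ _); ring.
have h1 : b `^ (s1 + s2 - t) <= h `^ (s1 + s2 - t) by rewrite powR_lel// subr_ge0.
have p1 := powR_ge0 h (t - s1); have p2 := powR_ge0 b (t - s2).
have := ler_wpM2r (mulr_ge0 p1 p2) h1; lra.
Qed.

(** The projection attached to a rectangle is the one on its longer side, and for
t <= s1 + s2 that side realises the maximum. *)
Lemma psi_max t w : t <= s1 + s2 -> (forall w, is_typeB S w = false) \/ s1 = s2 ->
  psi t w = Num.max (weight1 t (base_len S w) (height_len S w))
                    (weight2 t (base_len S w) (height_len S w)).
Proof.
move=> ts sep; rewrite psiE word_dimE /proj_horizontal.
have b0 := base_len_gt0 S w; have h0 := height_len_gt0 S w.
rewrite /long_side /short_side; have [bh|hb] := ltP (base_len S w) (height_len S w).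
  rewrite (max_idPr (weight_ge ts b0 (ltW bh))) /weight2.
  by case: sep => [-> //|->]; case: ifP.
rewrite (max_idPl (weight_le ts h0 hb)) /weight1.
by case: sep => [-> //|->]; case: ifP.
Qed.

Lemma weight1M t b h b' h' : 0 < b -> 0 < h -> 0 < b' -> 0 < h' ->
  weight1 t (b * b') (h * h') = weight1 t b h * weight1 t b' h'.
Proof. by move=> *; rewrite /weight1 !powRM ?ltW// mulrACA. Qed.

Lemma weight2M t b h b' h' : 0 < b -> 0 < h -> 0 < b' -> 0 < h' ->
  weight2 t (b * b') (h * h') = weight2 t b h * weight2 t b' h'.
Proof. by move=> *; rewrite /weight2 !powRM ?ltW// mulrACA. Qed.

Lemma psi_submultiplicative t u v : t <= s1 + s2 ->
  psi t (u ++ v) <= psi t u * psi t v.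
Proof.
move=> ts; have sep := typeB_or_dims_eq; rewrite !psi_max//.
have bu := base_len_gt0 S u; have hu := height_len_gt0 S u.
have bv := base_len_gt0 S v; have hv := height_len_gt0 S v.
have w1 b h : 0 <= weight1 t b h by rewrite mulr_ge0 ?powR_ge0.
have w2 b h : 0 <= weight2 t b h by rewrite mulr_ge0 ?powR_ge0.
rewrite base_len_cat height_len_cat.
have [tB|tA] := boolP (is_typeB S u); last first.
  rewrite weight1M// weight2M// ge_max; apply/andP; split; apply: ler_pM => //;
    by rewrite le_max lexx ?orbT.
(* now s1 = s2, so swapping b and h exchanges the two expressions *)
have E : s1 = s2 by case: sep => // nB; rewrite nB in tB.
have W b h : weight2 t b h = weight1 t h b by rewrite /weight1 /weight2 E.
rewrite weight1M// weight2M// !W ge_max; apply/andP; split; apply: ler_pM => //;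
  by rewrite le_max lexx ?orbT.
Qed.

(** For t < s the sums over a stopping set of the modified singular values exceed
one at every scale below one: otherwise submultiplicativity would keep the sums over words
of length k bounded, against their exponential growth. *)
Lemma lower_box_dim_attractor s : ROSC S -> P S s1 s2 s = 1 ->
  (s%:E <= lower_box_dim (@eucl_dist R) F)%E.
Proof.
move=> rosc Ps; have ss := exponent_le_dim_sum rosc Ps.
apply/lee_subgt0Pr => x x0; have x20 : 0 < x / 2 by rewrite divr_gt0.
have [c [C [[/andP[c0 c1] C01] _ hC _ hc]]] := contraction_bounds S.
pose t := s - x / 2; have ts : t < s by rewrite gtrBl.
have [C' C'0 h] := antichain_sum_le t rosc c0 x20.
rewrite -EFinB (_ : s - x = t - x / 2); last by rewrite /t -addrA -opprD -splitr.
apply: (lower_box_dim_ge C'0 ltr01) => r n /andP[r0 r1] hn.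
have [K CK] := exp_small C01 r0.
have anti := @stopping_set_antichain _ _ _ r K (short_side_cat S).
have uQ := @stopping_set_uniq I _ (short_side S) r K.
apply: le_trans (h r _ n r0 uQ anti _ hn); last first.
  by move=> w; rewrite mem_stopping_set => /andP[/(stopped_short_side hc c0)].
rewrite -[leLHS]mulr1 ler_wpM2l ?mulr_ge0 ?powR_ge0 ?(ltW C'0)//.
rewrite leNgt; apply/negP => /ltW sum1.
have [||||B hB] := @submultiplicative_bounded _ _ _ r K (psi t) _ _ _ _ sum1.
- by move=> w; apply/ltW/psi_gt0.
- by move=> u v; apply: psi_submultiplicative; exact: le_trans (ltW ts) ss.
- by rewrite short_side_nil.
- move=> w wK; apply: le_trans (short_le_long _ _) _; apply: le_trans (hC w) _.
  by rewrite wK.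
apply: (@Psi_unbounded _ _ S s1 s2 s t `|B| Ps ts) => k; rewrite PsiE.
apply: (le_trans (hB k)); apply: (le_trans (ler_norm B)).
by rewrite ler_peMr// ler1n.
Qed.

End lower_bound.

(** * Packing dimension *)

Section packing.
Context {R : realType} {T : choiceType} (d : T -> T -> R).
Hypothesis d_refl : forall x, d x x = 0.
Implicit Types (E : set T) (s t u r e : R) (B : set (T * R)).

Lemma esum_le_seq (V : choiceType) (B : set V) (f : V -> R) (M : R) :
  (forall l : seq V, uniq l -> (forall p, p \in l -> B p) -> \sum_(p <- l) f p <= M) ->
  (\esum_(p in B) (f p)%:E <= M%:E)%E.
Proof.
move=> h; apply: ge_ereal_sup => _ [A [finA AB] <-].
rewrite fsbig_finite// sumEFin lee_fin; apply: h; first exact: finmap.fset_uniq.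
by move=> p; rewrite in_fset_set// inE => /AB.
Qed.

Lemma seq_le_esum (V : choiceType) (B : set V) (f : V -> R) (l : seq V) :
  uniq l -> (forall p, p \in l -> B p) ->
  ((\sum_(p <- l) f p)%:E <= \esum_(p in B) (f p)%:E)%E.
Proof.
move=> ul lB; apply: esum_ge; exists [set` l].
  by split; [exact: finite_seq|move=> p /= /lB].
by rewrite -fsbig_seq// sumEFin.
Qed.

Lemma packing_pre_delta_ge0 t r E : (0 <= packing_pre_delta d t r E)%E.
Proof.
apply: le_ereal_sup_tmp; exists (\esum_(p in (set0 : set (T * R))) ((2 * p.2) `^ t)%:E)%E; last exact: esum_ge0.
by exists set0 => //; split.
Qed.

Lemma packing_pre_delta_le t r r' E : r <= r' ->
  (packing_pre_delta d t r E <= packing_pre_delta d t r' E)%E.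
Proof.
move=> rr'; apply: ereal_sup_le => _ [B [cB hB tB] <-]; exists B => //.
split=> // p /hB [Ep /andP[p0 pr]]; split=> //.
by rewrite p0 (le_trans pr).
Qed.

(** The limit is an infimum, as shrinking the radii leaves fewer packings. *)
Lemma packing_preE t E : packing_pre d t E =
  ereal_inf [set packing_pre_delta d t r E | r in [set r | 0 < r]].
Proof.
apply/cvg_lim => //.
have h := @nondecreasing_at_right_cvge _ (fun r => packing_pre_delta d t r E) 0 +oo%O.
have -> : [set r : R | 0 < r] = [set` Interval (BRight 0) +oo%O].
  by apply/seteqP; split=> r /=; rewrite in_itv/= andbT.
by apply: h => // r r' _ _; exact: packing_pre_delta_le.
Qed.

Lemma packing_pre_ge0 t E : (0 <= packing_pre d t E)%E.
Proof.
by rewrite packing_preE; apply: le_ereal_inf_tmp => _ [r _ <-]; exact: packing_pre_delta_ge0.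
Qed.

Lemma packing_pre_lty t E : (packing_pre d t E < +oo)%E ->
  exists r M, 0 < r /\ forall (l : seq (T * R)), uniq l ->
    (forall p, p \in l -> E p.1 /\ 0 < p.2 <= r) ->
    {in l &, forall p q, (pball d p `&` pball d q) !=set0 -> p = q} ->
    \sum_(p <- l) (2 * p.2) `^ t <= M.
Proof.
rewrite packing_preE => /ereal_inf_lt [_ [r r0 <-] hlt].
have fin : packing_pre_delta d t r E \is a fin_num.
  by rewrite ge0_fin_numE ?packing_pre_delta_ge0.
exists r, (fine (packing_pre_delta d t r E)); split=> // l ul hl tl.
rewrite -lee_fin fineK//; apply: le_ereal_sup_tmp.
exists (\esum_(p in [set` l]) ((2 * p.2) `^ t)%:E)%E; last exact: seq_le_esum.
exists [set` l] => //; split=> [|p /= /hl//|p q /= lp lq]; last exact: tl.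
exact/finite_set_countable/finite_seq.
Qed.

(** The centres of the balls of radius more than r of a packing are at mutual
distance more than r, so a set of diameter at most r contains at most one of
them. *)
Lemma packing_card E r n (l : seq (T * R)) : covered d E r n -> uniq l ->
  (forall p, p \in l -> E p.1 /\ r < p.2) -> 0 <= r ->
  {in l &, forall p q, (pball d p `&` pball d q) !=set0 -> p = q} ->
  (size l <= n)%N.
Proof.
move=> [U [cU dU]] ul hl r0 tl; case E0: l => [//|p0 l0]; rewrite -E0.
have p0l : p0 \in l by rewrite E0 mem_head.
have [j0 _ _] := cU _ (proj1 (hl p0 p0l)).
have hU p : exists j : 'I_n, p \in l -> U j p.1.
  have [pl|_] := boolP (p \in l); last by exists j0.
  by have [j _ Uj] := cU _ (proj1 (hl p pl)); exists j.
have [f hf] := choice hU.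
have inj : {in l &, injective f}.
  move=> p q pl ql fpq; have Ui := hf p pl; have Uj := hf q ql.
  rewrite -fpq in Uj; apply: tl => //; exists q.1; split; rewrite /pball /=.
    by apply: (le_trans (dU _ _ _ Ui Uj)); have [_ /ltW] := hl p pl.
  by rewrite d_refl; have [_ /ltW h] := hl q ql; apply: le_trans h.
rewrite -(size_map f) -[leqRHS]card_ord.
have /card_uniqP <- : uniq (map f l) by rewrite map_inj_in_uniq.
exact: max_card.
Qed.

Lemma dyadic_scale r : 0 < r <= 1 -> exists k : nat, 2^-1 ^+ k.+1 < r <= 2^-1 ^+ k.
Proof.
move=> /andP[r0 r1].
have [K hK] : exists K, (2^-1 : R) ^+ K <= r / 2.
  apply: exp_small; last by rewrite divr_gt0.
  by apply/andP; split; lra.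
have ex : exists k, (2^-1 : R) ^+ k.+1 < r.
  exists K; apply: le_lt_trans (_ : _ <= r / 2) _; last lra.
  apply: le_trans hK; rewrite exprS; have : 0 <= (2^-1 : R) ^+ K by rewrite exprn_ge0//; lra.
  lra.
case: (ex_minnP ex) => k hk kmin; exists k; rewrite hk/=.
case: k kmin {hk} => [_|k kmin]; first by rewrite expr0.
by rewrite leNgt; apply/negP => /kmin; rewrite ltnn.
Qed.

(** A packing has at most about 2 ^ (k * u) balls of radius close to 2 ^ - k, for
any u above the upper box dimension; hence for t > u the sum over a packing
with small radii is dominated by the tail of a geometric series. *)
Lemma packing_pre_eq0 E t : (0 <= upper_box_dim d E)%E -> (upper_box_dim d E < t%:E)%E ->
  packing_pre d t E = 0%E.
Proof.
move=> ub0 ubt.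
have [b ubE] : exists b : R, upper_box_dim d E = b%:E.
  by case: (upper_box_dim d E) ub0 ubt => [b| |]//; exists b.
rewrite ubE lee_fin in ub0; rewrite ubE lte_fin in ubt.
pose u := (b + t) / 2; have [bu ut] := midf_lt ubt; rewrite -/u in bu ut.
have u0 : 0 <= u by rewrite ltW// (le_lt_trans ub0).
have t0 : 0 <= t by rewrite (le_trans u0)// ltW.
have [|e e0 he] := @upper_box_dim_ltP _ _ d E u; first by rewrite ubE lte_fin.
pose h : R := 2^-1; have h01 : 0 < h < 1 by rewrite /h; apply/andP; split; lra.
have h0 : 0 < h by case/andP: h01.
pose x := h `^ (t - u).
have x01 : 0 < x < 1.
  rewrite /x powR_gt0//= powR_exp// expR_lt1 pmulr_rlt0 ?subr_gt0//.
  exact: ln_lt0.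
have [x0 x1] := andP x01.
(* a ball of radius p with h ^ k.+1 < p <= h ^ k contributes at most (2 * h ^ k) ^ t,
and there are at most 2 * (h ^ k.+1) ^ - u of them: in all at most A * x ^ k *)
pose A : R := (2 * h^-1) `^ t * 2.
have A0 : 0 < A by rewrite mulr_gt0// powR_gt0// mulr_gt0// invr_gt0.
apply/eqP; rewrite eq_le packing_pre_ge0 andbT.
apply/lee_addgt0Pr => y y0; rewrite add0e.
have [K1 hK1] := exp_small h01 (r := e / 2) ltac:(by rewrite divr_gt0).
have [K2 hK2] := exp_small x01 (r := y * (1 - x) / A) ltac:(by rewrite divr_gt0// mulr_gt0// subr_gt0).
pose K := maxn K1 K2.
rewrite packing_preE; apply: ge_ereal_inf; exists (packing_pre_delta d t (h ^+ K) E).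
  by exists (h ^+ K) => //=; rewrite exprn_gt0.
apply: ge_ereal_sup => _ [B [_ hB tB] <-]; apply: esum_le_seq => l ul lB.
have hk p : exists k : nat, p \in l -> h ^+ k.+1 < p.2 <= h ^+ k.
  have [pl|_] := boolP (p \in l); last by exists 0%N.
  have [_ /andP[p0 pK]] := hB p (lB p pl).
  have [|k hk] := @dyadic_scale p.2; last by exists k.
  by rewrite p0 (le_trans pK)// exprn_ile1// ltW//; case/andP: h01.
have [g hg] := choice hk.
have gK p : p \in l -> (K <= g p)%N.
  move=> pl; have [_ /andP[_ pK]] := hB p (lB p pl); have /andP[glt _] := hg p pl.
  have := lt_le_trans glt pK; rewrite leqNgt; apply: contraTN => gK.
  by rewrite -leNgt ler_wiXn2l// ltW//; case/andP: h01.
pose L := \max_(p <- l) g p.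
have gL p : p \in l -> (g p < L.+1)%N by move=> pl; rewrite ltnS leq_bigmax_seq.
rewrite (partition_big (fun p => inord (g p) : 'I_L.+1) xpredT)//=.
apply: (@le_trans _ _ (\sum_(k < L.+1) (if (K <= k)%N then A * x ^+ k else 0))).
  apply: ler_sum => k _; rewrite -big_filter; set lk := [seq p <- l | _].
  have lkP p : p \in lk -> p \in l /\ g p = k.
    rewrite mem_filter => /andP[/eqP gk pl]; split=> //.
    by rewrite -gk inordK// gL.
  have [Kk|kK] := leqP K k; last first.
    rewrite big_seq big1// => p /lkP[pl gpk]; move: (gK p pl).
    by rewrite gpk leqNgt kK.
  have hk1 : 0 < h ^+ k.+1 < e.
    rewrite exprn_gt0//=; apply: (@le_lt_trans _ _ (h ^+ K1)).
      rewrite ler_wiXn2l//; [exact: ltW|by case/andP: h01 => _ /ltW|].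
      by rewrite (leq_trans (leq_maxl K1 K2))// (leq_trans Kk).
    by apply: (le_lt_trans hK1); rewrite gtr_pMr// invf_lt1 ?ltr1n.
  have [n [hn nle]] := he _ hk1.
  have sz : (size lk <= n)%N.
    apply: packing_card hn _ _ _ _; first exact: filter_uniq.
    - move=> p /lkP[pl gpk]; have [Ep _] := hB p (lB p pl); split=> //.
      by have /andP[] := hg p pl; rewrite gpk.
    - by rewrite exprn_ge0// ltW.
    - by move=> p q /lkP[/lB Bp _] /lkP[/lB Bq _]; exact: tB.
  apply: (@le_trans _ _ (\sum_(p <- lk) (2 * h ^+ k) `^ t)).
    rewrite big_seq [leRHS]big_seq; apply: ler_sum => p /lkP[pl gpk].
    have /andP[p1 p2] := hg p pl; rewrite gpk in p1 p2.
    rewrite powR_lel// ?ler_pM2l// mulr_gt0//.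
    by apply: lt_trans p1; rewrite exprn_gt0.
  rewrite big_const_seq count_predT iter_addr_0 -[leLHS]mulr_natl.
  have snle : (size lk)%:R <= (h ^+ k.+1) `^ (- u) *+ 2.
    by apply: le_trans nle; rewrite ler_nat.
  apply: (le_trans (ler_wpM2r (powR_ge0 _ _) snle)).
  have -> : (h ^+ k.+1) `^ (- u) = h `^ (- (k.+1%:R * u)).
    by rewrite -powR_mulrn ?(ltW h0)// -powRrM mulrN.
  have -> : (2 * h ^+ k) `^ t = 2 `^ t * h `^ (k%:R * t).
    by rewrite powRM ?exprn_ge0 ?(ltW h0)// -powR_mulrn ?(ltW h0)// -powRrM.
  have -> : x ^+ k = h `^ (k%:R * (t - u)).
    by rewrite -powR_mulrn ?(ltW x0)// -powRrM mulrC.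
  have -> : A = 2 `^ t * h `^ (- t) * 2.
    by rewrite /A powRM ?invr_ge0 ?(ltW h0)// -[h^-1]powR_inv1 ?(ltW h0)// -powRrM mulN1r.
  have hu : h `^ (- (k.+1%:R * u)) * h `^ (k%:R * t) <= h `^ (- t) * h `^ (k%:R * (t - u)).
    rewrite -!powRDp// ger_powR ?h0//=; first by case/andP: h01 => _ /ltW.
    by rewrite -natr1; lra.
  have p2 := powR_ge0 2 t.
  rewrite -[h `^ _ *+ 2]mulr_natl; have := ler_wpM2l (mulr_ge0 p2 (ler0n R 2)) hu; lra.
have xn n : 0 <= x ^+ n by rewrite exprn_ge0// ltW.
have AK : 0 <= A * x ^+ K by apply: mulr_ge0 => //; exact: ltW.
apply: (@le_trans _ _ (\sum_(j < L.+1) A * x ^+ K * x ^+ j)).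
  rewrite -(big_mkord xpredT (fun k => if (K <= k)%N then A * x ^+ k else 0)).
  have [LK|KL] := leqP L.+1 K.
    rewrite big_nat big1 ?sumr_ge0// => [j _|k /andP[_ kL]].
      exact: mulr_ge0.
    by rewrite leqNgt (leq_trans kL LK).
  rewrite (big_cat_nat (n := K))//=; last exact: ltnW.
  rewrite big_nat big1 ?add0r; last by move=> k /andP[_ kK]; rewrite leqNgt kK.
  rewrite -{1}[K]add0n big_addn big_mkord.
  apply: (@le_trans _ _ (\sum_(i < L.+1 - K) A * x ^+ K * x ^+ i)).
    by apply: ler_sum => i _; rewrite leq_addl exprD -mulrA [x ^+ i * _]mulrC.
  rewrite -!(big_mkord xpredT (fun i => A * x ^+ K * x ^+ i)).
  rewrite [leRHS](big_cat_nat (n := (L.+1 - K)%N))//=; last exact: leq_subr.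
  rewrite lerDl sumr_ge0// => j _.
  exact: mulr_ge0.
rewrite -mulr_sumr; apply: (@le_trans _ _ (A * x ^+ K * (1 - x)^-1)).
  by rewrite ler_wpM2l ?geometric_sum_le.
rewrite ler_pdivrMr ?subr_gt0// mulrC -ler_pdivlMr//.
apply: le_trans hK2; rewrite ler_wiXn2l//; [exact: ltW|exact: ltW|exact: leq_maxr].
Qed.

End packing.

Section packing_cover.
Context {R : realType} {T : choiceType} (d : T -> T -> R).
Hypothesis d_refl : forall x, d x x = 0.
Hypothesis d_sym : forall x y, d x y = d y x.
Hypothesis d_triangle : forall x y z, d x z <= d x y + d y z.

Definition metric_closure (E : set T) : set T :=
  [set x | forall e : R, 0 < e -> exists2 y, E y & d x y < e].

(** The centres of a maximal packing by balls of radius r form a 2 * r net, and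
their number is controlled by the sum over the packing. *)
Lemma covered_of_packing_pre t (E : set T) : (packing_pre d t E < +oo)%E ->
  exists r0 C : R, [/\ 0 < r0, 0 < C & forall r, 0 < r < r0 ->
    exists2 n, covered d (metric_closure E) (6 * r) n & n%:R <= C * r `^ (- t)].
Proof.
move=> /packing_pre_lty[r0 [M [r00 hM]]].
exists r0, ((`|M| + 1) * 2 `^ (- t)); split=> // r /andP[rp rr0].
pose net (l : seq T) := [/\ uniq l, forall x, x \in l -> E x &
  {in l &, forall x y, d x y <= 2 * r -> x = y}].
pose PN n := `[< exists2 l, net l & size l = n >].
have size_net l : net l -> (size l)%:R <= (`|M| + 1) * 2 `^ (- t) * r `^ (- t).
  move=> [ul lE sep]; have := hM [seq (x, r) | x <- l] _ _ _.
  rewrite big_map /= big_const_seq count_predT iter_addr_0 => h.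
  rewrite -mulrA -powRM ?(ltW rp)// powRN ler_pdivlMr ?powR_gt0 ?mulr_gt0//.
  rewrite [leLHS]mulr_natl; apply: (@le_trans _ _ M); last first.
    by apply: (le_trans (ler_norm M)); rewrite lerDl.
  apply: h; first by rewrite map_inj_uniq// => x y [].
    by move=> _ /mapP[x xl ->]; split; [exact: lE|rewrite rp ltW].
  move=> _ _ /mapP[x xl ->] /mapP[y yl ->] [z []]; rewrite /pball/= => xz yz.
  congr pair; apply: sep => //; apply: le_trans (d_triangle x z y) _.
  by rewrite [d z y]d_sym mulr2n mulrDl mul1r lerD.
pose N := Num.trunc ((`|M| + 1) * 2 `^ (- t) * r `^ (- t)).
have ex : exists n, PN n by exists 0%N; apply/asboolP; exists [::].
have ub n : PN n -> (n <= N)%N.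
  move=> /asboolP[l /size_net h <-]; rewrite /N truncn_ge_nat//.
  exact: le_trans h.
case: (ex_maxnP ex ub) => n /asboolP[l hl sl] nmax.
have [ul lE sep] := hl.
exists n; last by rewrite -sl; exact: size_net.
have net_dense y : E y -> exists2 x, x \in l & d x y <= 2 * r.
  move=> Ey; apply: contrapT => no.
  have far x : x \in l -> 2 * r < d x y.
    by move=> xl; rewrite ltNge; apply/negP => h; apply: no; exists x.
  have r2 : 0 <= 2 * r by rewrite mulr_ge0// ltW.
  have /nmax : PN n.+1; last by rewrite ltnn.
  apply/asboolP; exists (y :: l); last by rewrite /= sl.
  split.
  - rewrite /= ul andbT; apply/negP => /far; rewrite d_refl.
    by rewrite ltNge r2.
  - by move=> x; rewrite inE => /orP[/eqP ->//|/lE].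
  - move=> x z; rewrite !inE => /orP[/eqP ->|xl] /orP[/eqP ->|zl] //.
    + by rewrite d_sym leNgt far.
    + by rewrite leNgt far.
    + exact: sep.
rewrite -sl; exists (fun i => [set y | d (tnth (in_tuple l) i) y <= 3 * r]); split.
  move=> y hy; have [z Ez yz] := hy r rp; have [x xl xz] := net_dense z Ez.
  have /tnthP[i xi] : x \in in_tuple l by [].
  exists i => //=; rewrite -xi; apply: le_trans (d_triangle x z y) _.
  by rewrite [d z y]d_sym; lra.
move=> i y z /= hy hz; apply: le_trans (d_triangle _ (tnth (in_tuple l) i) _) _.
by rewrite d_sym; lra.
Qed.

End packing_cover.

Section attractor_packing.
Context {R : realType} {I : finType} (S : box_like_ifs R I).
Context (F : set 'cV[R]_2) (attractorF : is_attractor S F).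
Implicit Types (w : seq I) (x y z : 'cV[R]_2).

Local Notation dist := (@eucl_dist R).

Lemma nbhs_eucl x (B : set 'cV[R]_2) : nbhs x B ->
  exists2 e : R, 0 < e & forall y, dist x y < e -> B y.
Proof.
move=> /nbhs_ballP[e /= e0 h]; exists e => // y xy; apply: h.
split=> // i j; rewrite (ord1 j) -ball_normE /=.
exact: le_lt_trans (eucl_dist_coord _ _ _) xy.
Qed.

Lemma eucl_nbhs x (e : R) : 0 < e -> nbhs x [set y | dist x y < e].
Proof.
move=> e0; apply/nbhs_ballP; exists (e / 2) => /=; first by rewrite divr_gt0.
move=> y [_ h] /=; apply: le_lt_trans (eucl_dist_le _ _) _.
have := h 0 0; have := h 1 0; rewrite -!ball_normE /= => h1 h0.
by rewrite [e]splitr; exact: ltrD.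
Qed.

Lemma attractor_closed : metric_closure dist F `<=` F.
Proof.
have [_ cF _] := attractorF => x hx.
have : closed F by apply: compact_closed cF; exact: norm_hausdorff.
apply=> B /nbhs_eucl[e e0 hB]; have [y Fy xy] := hx e e0.
by exists y; split=> //; exact: hB.
Qed.

Lemma word_map_expand w x y :
  short_side S w * dist x y <= dist (word_map S w x) (word_map S w y).
Proof.
rewrite !eucl_distE -(real_normK (num_real (word_map _ _ _ 0 0 - _))).
rewrite -(real_normK (num_real (word_map _ _ _ 1 0 - _))).
rewrite word_map_dist0 word_map_dist1.
have s0 := ltW (short_side_gt0 S w).
have sb : short_side S w ^+ 2 <= base_len S w ^+ 2.
  by rewrite lerXn2r ?nnegrE ?(ltW (base_len_gt0 _ _))// ge_min lexx.
have sh : short_side S w ^+ 2 <= height_len S w ^+ 2.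
  by rewrite lerXn2r ?nnegrE ?(ltW (height_len_gt0 _ _))// ge_min lexx orbT.
rewrite -[short_side S w]ger0_norm// -sqrtr_sqr -sqrtrM ?sqr_ge0// ler_wsqrtr//.
rewrite !exprMn; case: (is_typeB S w); rewrite !real_normK ?num_real// mulrDr.
  by rewrite addrC lerD// ler_wpM2r ?sqr_ge0.
by rewrite lerD// ler_wpM2r ?sqr_ge0.
Qed.

Lemma word_map_contract w x y : dist (word_map S w x) (word_map S w y) <=
  long_side S w * (`|x 0 0 - y 0 0| + `|x 1 0 - y 1 0|).
Proof.
apply: le_trans (eucl_dist_le _ _) _; rewrite word_map_dist0 word_map_dist1 mulrDr.
have bl : base_len S w <= long_side S w by rewrite le_max lexx.
have hl : height_len S w <= long_side S w by rewrite le_max lexx orbT.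
by case: (is_typeB S w); [rewrite [leRHS]addrC|]; apply: lerD; rewrite ler_wpM2r.
Qed.

Lemma word_map_surj w z : exists y, word_map S w y = z.
Proof.
set t := word_map S w 0; case: (monomialP (word_lin_monomial S w)) => p q e1 e2.
  exists (vec2 ((z 0 0 - t 0 0) / word_lin S w 0 0) ((z 1 0 - t 1 0) / word_lin S w 1 1)).
  apply: col2P; rewrite word_mapE -/t mxE mulmx2E vec2_0 vec2_1.
    by rewrite e1 mul0r addr0 mulrCA divff// mulr1 subrK.
  by rewrite e2 mul0r add0r mulrCA divff// mulr1 subrK.
exists (vec2 ((z 1 0 - t 1 0) / word_lin S w 1 0) ((z 0 0 - t 0 0) / word_lin S w 0 1)).
apply: col2P; rewrite word_mapE -/t mxE mulmx2E vec2_0 vec2_1.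
  by rewrite e1 mul0r add0r mulrCA divff// mulr1 subrK.
by rewrite e2 mul0r addr0 mulrCA divff// mulr1 subrK.
Qed.

(** Nested cylinders have a common point: a cluster point of a sequence of points
taken in them, which lies in each of them because cylinders are closed. *)
Lemma nested_cylinders (v : nat -> seq I) :
  exists2 z, F z & forall k, exists2 y, F y &
    word_map S (flatten [seq v j | j <- iota 0 k]) y = z.
Proof.
have [[x Fx] cF _] := attractorF.
pose W k := flatten [seq v j | j <- iota 0 k].
pose u (k : nat) := word_map S (W k) x.
have split_W k j : (k <= j)%N -> exists s, W j = W k ++ s.
  move=> kj; exists (flatten [seq v i | i <- iota k (j - k)]).
  by rewrite /W -{1}(subnKC kj) iotaD map_cat flatten_cat add0n.
have FG : (u @ \oo) F by exists 0%N => // k _; exact: word_map_attractor.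
have [z [Fz clz]] := cF (u @ \oo) _ FG.
exists z => // k; have [y yz] := word_map_surj (W k) z; exists y => //.
apply: attractor_closed => e e0.
have se0 : 0 < short_side S (W k) * e by rewrite mulr_gt0// short_side_gt0.
have [_ [[j kj <-] zj]] := clz [set u j | j in [set j | (k <= j)%N]] _
    ltac:(by exists k => // j /= kj; exists j) (eucl_nbhs z se0).
have [s Ws] := split_W k j kj.
exists (word_map S s x); first exact: word_map_attractor.
rewrite -(ltr_pM2l (short_side_gt0 S (W k))).
apply: le_lt_trans (word_map_expand _ _ _) _.
by rewrite yz -[word_map S (W k) _]/((word_map S (W k) \o word_map S s) x) -word_map_cat -Ws.
Qed.

(** This is the Baire category argument for F: otherwise every cylinder would have
a subcylinder avoiding C 0, this one a subcylinder avoiding C 1, and so on, and a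
common point of these nested cylinders would lie in none of the sets. *)
Lemma closure_contains_cylinder (C : nat -> set 'cV[R]_2) : F `<=` \bigcup_k C k ->
  exists k w, forall y, F y -> metric_closure dist (C k) (word_map S w y).
Proof.
move=> FC; apply: contrapT => no.
have [D D0 hD] := attractor_bounded attractorF.
have [c [C' [[_ C01] _ hC _ _]]] := contraction_bounds S.
have avoid (kw : nat * seq I) : exists v, forall x, F x ->
    ~ C kw.1 (word_map S (kw.2 ++ v) x).
  case: kw => k w /=.
  have [y Fy /existsNP[e /not_implyP[e0 he]]] : exists2 y, F y &
      ~ metric_closure dist (C k) (word_map S w y).
    apply: contrapT => h; apply: no; exists k, w => y Fy.
    by apply: contrapT => h'; apply: h; exists y.
  have [|K hK] := exp_small C01 (r := e / (2 * (D + D))).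
    by rewrite divr_gt0// mulr_gt0// addr_gt0.
  have [v vK [y' Fy' yE]] := attractor_words attractorF K Fy.
  exists v => x Fx Cx; apply: he; exists (word_map S (w ++ v) x) => //.
  have -> : word_map S w y = word_map S (w ++ v) y' by rewrite word_map_cat /= yE.
  apply: le_lt_trans (word_map_contract _ _ _) _.
  have Lv : long_side S (w ++ v) <= e / (2 * (D + D)).
    apply: le_trans hK; apply: le_trans (hC _) _; rewrite size_cat vK.
    by case/andP: C01 => C0 C1; rewrite ler_wiXn2l ?leq_addl// ltW.
  have d0 := hD _ _ 0 Fy' Fx; have d1 := hD _ _ 1 Fy' Fx.
  apply: (@le_lt_trans _ _ (e / (2 * (D + D)) * (D + D))).
    by apply: ler_pM; [exact/ltW/long_side_gt0|rewrite addr_ge0|exact: Lv|exact: lerD].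
  have DD : D + D != 0 by rewrite gt_eqF// addr_gt0.
  rewrite (_ : _ * _ = e / 2); last by field.
  by rewrite gtr_pMr// invf_lt1 ?ltr1n.
have [g hg] := choice avoid.
pose wk := fix wk k := if k is k'.+1 then wk k' ++ g (k', wk k') else [::].
pose v k := g (k, wk k).
have wkE k : wk k = flatten [seq v j | j <- iota 0 k].
  elim: k => [//|k IH]; rewrite -addn1 iotaD map_cat flatten_cat -IH addn1 /=.
  by rewrite cats0 add0n.
have [z Fz hz] := nested_cylinders v.
(* z lies in some C k, but the (k+1)st cylinder was chosen to avoid C k *)
have [k _ Ckz] := FC z Fz; have [y Fy yz] := hz k.+1.
by apply: (hg (k, wk k) y Fy); rewrite /= -[wk k ++ _]/(wk k.+1) wkE yz.
Qed.

Lemma covered_attractor_of_cylinder w (E : set 'cV[R]_2) r n :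
  (forall y, F y -> E (word_map S w y)) -> covered dist E r n ->
  covered dist F ((short_side S w)^-1 * r) n.
Proof.
move=> FE [U [cU dU]]; exists (fun i => [set x | U i (word_map S w x)]); split.
  by move=> x Fx; have [i _ Ui] := cU _ (FE x Fx); exists i.
move=> i x y Ux Uy; rewrite ler_pdivlMl ?short_side_gt0//.
exact: le_trans (word_map_expand _ _ _) (dU i _ _ Ux Uy).
Qed.

(** If F has packing measure zero in dimension t, it is covered by sets of finite
pre-measure, hence of upper box dimension at most t; the closure of one of them
contains a cylinder, which is a bi-Lipschitz copy of F. *)
Lemma upper_box_dim_le_packing_dim : (upper_box_dim dist F <= packing_dim dist F)%E.
Proof.
apply: le_ereal_inf_tmp => _ [t [t0 meas0] <-].
have : (packing_measure dist t F < 1)%E by rewrite meas0 lte_fin.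
move=> /ereal_inf_lt[_ [C FC <-] sumC].
have fin k : (packing_pre dist t (C k) < +oo)%E.
  apply: (@le_lt_trans _ _ 1%E); last exact: ltry.
  apply: le_trans (ltW sumC).
  apply: le_trans (nneseries_lim_ge k.+1 _); last by move=> n _ _; exact: packing_pre_ge0.
  by rewrite big_nat_recr//= leeDr// sume_ge0// => n _; exact: packing_pre_ge0.
have [k [w hw]] := closure_contains_cylinder FC.
have [r0 [M [r00 M0 h]]] := covered_of_packing_pre (@eucl_dist0 R) (@eucl_dist_sym R)
  (@eucl_dist_triangle R) (fin k).
apply: (@upper_box_dim_le _ _ _ _ _ M ((short_side S w)^-1 * 6) r0) => //.
  by rewrite mulr_gt0// invr_gt0 short_side_gt0.
move=> r /h[n hn nle]; exists n => //; rewrite -mulrA.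
exact: covered_attractor_of_cylinder hw hn.
Qed.

Lemma packing_dim_attractor (s : R) : (upper_box_dim dist F <= s%:E)%E ->
  packing_dim dist F = upper_box_dim dist F.
Proof.
move=> ubs; apply/eqP; rewrite eq_le upper_box_dim_le_packing_dim andbT.
have ub0 : (0 <= upper_box_dim dist F)%E.
  apply: le_trans (lower_le_upper_box_dim _ _).
  apply: (@lower_box_dim_ge _ _ _ _ _ 1 1) => // r n _ hn.
  rewrite oppr0 powRr0 mulr1 ler1n.
  by apply: covered_neq0 hn; case: attractorF.
have [b ubE] : exists b : R, upper_box_dim dist F = b%:E.
  by case: (upper_box_dim dist F) ub0 ubs => [b| |]//; exists b.
rewrite ubE; apply/lee_addgt0Pr => e e0; rewrite -EFinD.
apply: ereal_inf_lbound; exists (b + e) => //; split.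
  by rewrite addr_ge0 ?(ltW e0)// -lee_fin -ubE.
apply/eqP; rewrite eq_le; apply/andP; split.
  apply: ge_ereal_inf; exists (\sum_(0 <= k <oo) packing_pre dist (b + e) F)%E.
    by exists (fun=> F) => // x Fx; exists 0%N.
  rewrite eseries0// => k _ _; apply: packing_pre_eq0 => //; first exact: eucl_dist0.
  by rewrite ubE lte_fin ltrDl.
apply: le_ereal_inf_tmp => _ [C _ <-].
by apply: nneseries_ge0 => k _ _; exact: packing_pre_ge0.
Qed.

End attractor_packing.

Theorem theorem2p3 (R : realType) (I : finType) (hI : (2 <= #|I|)%N)
  (S : box_like_ifs R I) (F : set 'cV[R]_2) (hF : is_attractor S F)
  (s1 s2 : R)
  (hs1 : has_box_dim (@real_dist R) (@pi1 R @` F) s1)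
  (hs2 : has_box_dim (@real_dist R) (@pi2 R @` F) s2)
  (s : R) (hs0 : 0 <= s) (hs : P S s1 s2 s = 1) :
  (packing_dim (@eucl_dist R) F = upper_box_dim (@eucl_dist R) F /\
   (upper_box_dim (@eucl_dist R) F <= s%:E)%E) /\
  (ROSC S ->
   packing_dim (@eucl_dist R) F = s%:E /\
   has_box_dim (@eucl_dist R) F s).
Proof.
have ubs := upper_box_dim_attractor hF hs1 hs2 hs.
have pd := packing_dim_attractor hF ubs.
split=> [//|rosc]; have lbs := lower_box_dim_attractor hF hs1 hs2 rosc hs.
have lu := lower_le_upper_box_dim (@eucl_dist R) F.
have ubE : upper_box_dim (@eucl_dist R) F = s%:E.
  by apply/eqP; rewrite eq_le ubs (le_trans lbs lu).
have lbE : lower_box_dim (@eucl_dist R) F = s%:E.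
  by apply/eqP; rewrite eq_le lbs (le_trans lu ubs).
by rewrite pd ubE.
Qed.
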